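(* Let $n,q\ge1$ be integers and $m=qn$. Let $a_1,\dots,a_n\in\mathbb{C}$ with $a_n=1$, $b_0,\dots,b_m\in\mathbb{C}$ with $b_m\ne0$ (and set $a_0=0$), and consider the Airy operator $\mathcal{L}=\sum_{i=1}^{n}a_i\left(\frac{d}{dx}\right)^i-\sum_{j=0}^{m}b_jx^j$. Put $z=1/x$. Then the determining factors of $\mathcal{L}$ at $z=0$ (i.e. at $x=\infty$) are given by $$Q(z)=\frac{-1}{z^{1+q}}\left[\frac{\alpha_0}{1+q}+\frac{\alpha_n}{q}z+\dots+\frac{\alpha_{qn}}{1}z^q\right]=\frac{-1}{z^{1+q}}\sum_{s=0}^{q}\frac{\alpha_{sn}}{q+1-s}z^s,$$ where $(\alpha_0,\alpha_n,\dots,\alpha_{qn})$ is a solution of the system $$(\mathcal{A})\quad\begin{cases}\beta_{sn,n}=(-1)^nb_{m-s}, & 0\le s\le q-1,\\ \beta_{qn,n}=a_{n-1}\beta_{0,n-1}+(-1)^nb_{m-q},\end{cases}$$ and the determining factors depend only on $a_{n-1}$ and $b_{m-s}$ $(0\le s\le q)$.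
   Context: For given $\alpha_0,\alpha_n,\dots,\alpha_{qn}\in\mathbb{C}$ and integers $k\ge0$, $0\le s\le q$, $\beta_{sn,k}$ denotes the coefficient of $z^s$ in $\left(\sum_{j=0}^{q}\alpha_{jn}z^j\right)^k$ (so $\beta_{sn,1}=\alpha_{sn}$, $\beta_{0,k}=\alpha_0^k$, $\beta_{sn,k+1}=\sum_{j=0}^{s}\alpha_{jn}\beta_{(s-j)n,k}$). Determining factors: by the Hukuhara–Turrittin theorem, the equation $\mathcal{L}(u)=0$, rewritten in the variable $z=1/x$, has a basis of $n$ formal solutions near $z=0$ of the form $u_i(z)=e^{Q_i(z)}z^{\lambda_i}v_i(z)$, where $Q_i$ is a polynomial in $z^{-1/e}$ without constant term ($e$ a positive integer), $\lambda_i\in\mathbb{C}$, and $v_i$ is a polynomial in $\log z$ with coefficients formal power series in $z^{1/e}$. The $Q_i$ are the determining factors. *)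

(* Defs.v *)
From mathcomp Require Import all_boot all_order all_algebra.
From mathcomp Require Import all_classical all_reals.
From mathcomp.real_closed Require Import complex.

Set Implicit Arguments.
Unset Strict Implicit.
Unset Printing Implicit Defensive.

Import GRing.Theory Num.Theory.

Local Open Scope classical_set_scope.
Local Open Scope ring_scope.

(* An element [u] of [formal R] is a formal sum of the monomials
   exp (p (z^(-1/e))) * z^mu * (log z)^k, and [u p mu k] is the coefficient of
   that monomial. The ramification [e] is fixed by the context, the exponent
   mu ranges over the complex numbers, and only polynomials p with
   p`_0 = 0 are meant to occur, so that distinct indices stand for linearly
   independent monomials. No condition is put on supports here: see
   [is_formal]. *)
Definition formal (R : realType) : Type := {poly R[i]} -> R[i] -> nat -> R[i]^o.

Section Formal.
Variable R : realType.
Local Notation C := R[i].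

Definition mulz (r : C) (u : formal R) : formal R :=
  fun p mu k => u p (mu - r) k.

(* From
     (d/dz) (exp (p (z^(-1/e))) * z^nu * (log z)^k)
     = exp (p (z^(-1/e))) * (nu * z^(nu - 1) * (log z)^k
         + k * z^(nu - 1) * (log z)^(k - 1)
         - \sum_j (j / e) * p`_j * z^(nu - 1 - j / e) * (log z)^k),
   reading off the coefficient at (p, mu, k). *)
Definition derivz (e : nat) (u : formal R) : formal R :=
  fun p mu k =>
    (mu + 1) * u p (mu + 1) k + k.+1%:R * u p (mu + 1) k.+1
    - \sum_(j < size p)
        j%:R / e%:R * p`_j * u p (mu + 1 + j%:R / e%:R) k.

(* d/dx = - z^2 d/dz, since z = 1/x. *)
Definition derivx (e : nat) (u : formal R) : formal R :=
  - mulz 2 (derivz e u).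

Definition airy (e n m : nat) (a b : nat -> C) (u : formal R) : formal R :=
  \sum_(1 <= i < n.+1) a i *: iter i (derivx e) u
  - \sum_(j < m.+1) b j *: mulz (- j%:R) u.

(* exp (Q (z^(-1/e))) * z^lambda * v, where
   v = \sum_(k < size v) (\sum_l v_k l * z^(l/e)) * (log z)^k.
   For e > 0 at most one l contributes to the inner sum below. *)
Definition exp_term (e : nat) (Q : {poly C}) (lambda : C)
    (v : seq (nat -> C)) : formal R :=
  fun p mu k =>
    if p == Q then
      \sum_(l \in [set l : nat | lambda + l%:R / e%:R = mu])
        nth (fun=> 0) v k l
    else 0.

Definition is_formal (e : nat) (u : formal R) : Prop :=
  exists (r : nat) (Q : 'I_r -> {poly C}) (lambda : 'I_r -> C)
    (v : 'I_r -> seq (nat -> C)),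
    (forall i, (Q i)`_0 = 0) /\
    u = \sum_(i < r) exp_term e (Q i) (lambda i) (v i).

Definition is_basis (r : nat) (S : formal R -> Prop)
    (u : 'I_r -> formal R) : Prop :=
  [/\ forall i, S (u i),
      forall c : 'I_r -> C, \sum_(i < r) c i *: u i = 0 -> forall i, c i = 0
    & forall w, S w -> exists c : 'I_r -> C, w = \sum_(i < r) c i *: u i].

(* [Q i], read as a polynomial in z^(-1/e) without constant term, are the
   determining factors of the operator [L] of order n. *)
Definition determining_factors (e n : nat) (L : formal R -> formal R)
    (Q : 'I_n -> {poly C}) : Prop :=
  (forall i, (Q i)`_0 = 0) /\
  exists (lambda : 'I_n -> C) (v : 'I_n -> seq (nat -> C)),
    is_basis (fun w => is_formal e w /\ L w = 0)
      (fun i => exp_term e (Q i) (lambda i) (v i)).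

(* In the notations below the coefficient alpha_{jn} is [alpha j]. *)
Definition beta (q : nat) (alpha : 'I_q.+1 -> C) (s k : nat) : C :=
  ((\sum_(j < q.+1) alpha j *: 'X^j) ^+ k)`_s.

Definition systemA (n q : nat) (a b : nat -> C) (alpha : 'I_q.+1 -> C) : Prop :=
  (forall s : nat, (s < q)%N ->
     beta alpha s n = (-1) ^+ n * b (q * n - s)%N) /\
  beta alpha q n =
    a n.-1 * beta alpha 0 n.-1 + (-1) ^+ n * b (q * n - q)%N.

(* - z^(-(1 + q)) * \sum_s (alpha_s / (q + 1 - s)) * z^s, written as a
   polynomial in 1/z. *)
Definition Qalpha (q : nat) (alpha : 'I_q.+1 -> C) : {poly C} :=
  - \sum_(s < q.+1) (alpha s / (q.+1 - s)%:R) *: 'X^(q.+1 - s).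

End Formal.

(* Main.v *)
Require Import Defs.
From mathcomp Require Import all_boot all_order all_algebra.
From mathcomp Require Import separable.
From mathcomp Require Import all_classical all_reals.
From mathcomp.real_closed Require Import complex.
From mathcomp Require Import ring zify.

Set Implicit Arguments.
Unset Strict Implicit.
Unset Printing Implicit Defensive.

Import GRing.Theory Num.Theory.

Local Open Scope ring_scope.

(** Write a formal solution as a sum of components exp(P) f, where P runs over
    the polynomials in z^(-1/e) without constant term and f is a series in z and
    log z. The operator preserves each component and acts on f through
    D = d/dx + y, with y = dP/dx ([airy_component]). So it suffices to know for
    which P the conjugated operator has a kernel, and which one.

    Everything is read off the lowest exponent of f. An operator has order r
    when it acts like x^r to leading order, and its symbol is its action on the
    lowest coefficient ([has_symbol]). When the symbol is a nonzero constant
    there is no nonzero solution ([kernel_scalar]). Put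
    G(y) = sum_i a_i y^i - sum_j b_j x^j. The conjugated operator is
    multiplication by G(y) plus a sum of corrections a_i (D^i - y^i)
    ([airy_op_split]). If y has order q and leading coefficient c, the
    correction has order q (n - 1) - 1 and its symbol is an affine function of
    the exponent mu, namely - c^(n-1) (n mu - q 'C(n, 2)), up to a term that
    differentiates in log z ([has_symbol_ddx_rem_part]).

    A nonzero solution exists only if G(y) does not exceed this order. First, y must
    have order q with c^n = b_m ([airy_kernel_degree]). Next, two such y with the
    same c must be equal: all exponents of y exceed -1, and a difference
    u x^d + ... with d > -1 would give G a leading term n c^(n-1) u x^(d + q (n - 1))
    ([airy_kernel_unique]). In terms of
    y = - (alpha_0 x^q + ... + alpha_q), the condition on G(y) concerns its
    coefficients in degrees q n, ..., q n - q and is exactly the system (A)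
    ([size_airy_poly_reversal]), which has one solution for each of the n roots
    alpha_0 ([airy_systemA_family]).

    For these y the symbol of the operator is a nonzero multiple of
    mu - lambda + d/d(log z) for some lambda, so that the kernel is spanned by a
    single series z^lambda (1 + ...) without logarithms ([airy_kernel_dim1]). The
    n solutions obtained in this way have distinct exponentials and form a basis
    ([airy_determining_factors]). Since the exponentials in a basis do not depend
    on the basis ([determining_factors_eq]), they are the determining factors.
    Finally (A) only mentions a_(n-1) and b_(m-s) for s <= q. *)

(** * Orders and leading coefficients of polynomials *)

Section PolynomialPowers.
Variable A : comNzRingType.
Implicit Types P : {poly A}.

(** Degree bounds are written [size P <= d.+1], with [P`_d] allowed to vanish:
    d is then an order, additive under products, and the coefficient at that
    order is multiplicative. *)
Lemma size_exp_leqS P d i : (size P <= d.+1)%N -> (size (P ^+ i) <= (d * i).+1)%N.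
Proof.
move=> leP; rewrite (leq_trans (size_poly_exp_leq _ _)) // ltnS leq_mul2r.
by apply/orP; right; case: (size P) leP.
Qed.

Lemma size_mul_leqS P P' d d' :
    (size P <= d.+1)%N -> (size P' <= d'.+1)%N ->
  (size (P * P')%R <= (d + d').+1)%N.
Proof. by move=> leP leP'; apply: (leq_trans (size_polyMleq _ _)); lia. Qed.

Lemma coefM_top P P' d d' :
    (size P <= d.+1)%N -> (size P' <= d'.+1)%N ->
  (P * P')`_(d + d') = P`_d * P'`_d'.
Proof.
move=> leP leP'; rewrite coefM.
have ltd : (d < (d + d').+1)%N by rewrite ltnS leq_addr.
rewrite (bigD1 (Ordinal ltd)) //= addKn big1 ?addr0 // => i /eqP neq_id.
have [lt_id|] := ltnP i d; last first.
  rewrite leq_eqVlt => /predU1P[eq_id|lt_di]; first by case: neq_id; apply: val_inj.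
  by rewrite [P`_i]nth_default ?mul0r // (leq_trans leP).
by rewrite [P'`__]nth_default ?mulr0 // (leq_trans leP') //; lia.
Qed.

Lemma coef_exp_top P d i : (size P <= d.+1)%N -> (P ^+ i)`_(d * i) = P`_d ^+ i.
Proof.
move=> leP; elim: i => [|i IH]; first by rewrite muln0 !expr0 coef1.
by rewrite !exprS mulnS coefM_top ?IH // size_exp_leqS.
Qed.

Lemma size_comp_Xn P d e :
  (0 < e)%N -> (size P <= d.+1)%N -> (size (P \Po 'X^e) <= (d * e).+1)%N.
Proof.
move=> e_gt0 leP; apply/leq_sizeP => j ltj; rewrite coef_comp_poly_Xn //.
case: ifP => // /dvdnP[l eqj]; rewrite nth_default // eqj mulnK //.
by rewrite (leq_trans leP) // -(ltn_pmul2r e_gt0) -eqj.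
Qed.
End PolynomialPowers.

(** * Leading symbols of operators on formal series *)

Section Symbols.
Variables (C : numFieldType) (e : nat).
Hypothesis e_gt0 : (0 < e)%N.

Local Notation coef := (nat -> C^o).
Local Notation series := (C -> nat -> C^o).

Implicit Types (f : series) (h : coef) (A B : series -> series).
Implicit Types (phi psi : C -> coef -> coef) (g : {poly C}).

Let e_neq0 : e%:R != 0 :> C.
Proof. by rewrite pnatr_eq0 -lt0n. Qed.

(** A series f stands for the sum of the f mu k z^mu (log z)^k. Only exponents in
    the coset mu + Z/e are compared: the operators below never mix cosets. *)
Definition vanish_below (mu : C) f := forall l : nat, f (mu - l.+1%:R / e%:R) = 0.

(** A acts like x^r to leading order: it lowers the least exponent mu by r, and
    phi mu sends the coefficient of z^mu, a polynomial in log z, to that of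
    z^(mu - r). The order r is an upper bound, since phi may vanish. *)
Definition has_symbol (r : C) phi A :=
  forall mu f, vanish_below mu f ->
    vanish_below (mu - r) (A f) /\ A f (mu - r) = phi mu (f mu).

Lemma has_symbol_ext r r' phi phi' A A' :
    r = r' -> (forall mu h, phi mu h = phi' mu h) -> (forall f, A f = A' f) ->
  has_symbol r phi A -> has_symbol r' phi' A'.
Proof. by move=> <- ephi eA hA mu f /hA; rewrite eA ephi. Qed.

Lemma has_symbolD r phi psi A B :
    has_symbol r phi A -> has_symbol r psi B ->
  has_symbol r (fun mu h => phi mu h + psi mu h) (fun f => A f + B f).
Proof.
move=> hA hB mu f vf; have [vA eA] := hA _ _ vf; have [vB eB] := hB _ _ vf.
by split=> [l|]; rewrite fctE ?eA ?eB // vA vB addr0.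
Qed.

Lemma has_symbolZ r phi A (c : C) :
    has_symbol r phi A ->
  has_symbol r (fun mu h => c *: phi mu h) (fun f => c *: A f).
Proof.
move=> hA mu f vf; have [vA eA] := hA _ _ vf.
split=> [l|].
  by rewrite -[LHS]/(c *: (A f (mu - r - l.+1%:R / e%:R))) vA scaler0.
by rewrite -[LHS]/(c *: (A f (mu - r))) eA.
Qed.

Lemma has_symbolN r phi A :
  has_symbol r phi A -> has_symbol r (fun mu h => - phi mu h) (fun f => - A f).
Proof.
by move=> hA; apply: has_symbol_ext (has_symbolZ (-1) hA) => // *; rewrite scaleN1r.
Qed.

Lemma has_symbol_comp r s phi psi A B :
    has_symbol r phi A -> has_symbol s psi B ->
  has_symbol (r + s) (fun mu h => phi (mu - s) (psi mu h)) (fun f => A (B f)).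
Proof.
move=> hA hB mu f vf; have [vB <-] := hB _ _ vf.
by have := hA _ _ vB; rewrite -addrA -opprD [s + r]addrC.
Qed.

(** An order can be overestimated by a positive multiple of 1/e, at the price of a
    zero symbol; this is how lower order terms are discarded. *)
Lemma has_symbol_raise r phi A (l : nat) :
  (0 < l)%N -> has_symbol r phi A ->
  has_symbol (r + l%:R / e%:R) (fun=> fun=> 0) A.
Proof.
case: l => // l _ hA mu f vf; have [vA _] := hA _ _ vf.
split=> [j|]; last by rewrite opprD addrA.
have -> : mu - (r + l.+1%:R / e%:R) - j.+1%:R / e%:R =
    mu - r - (l + j.+1).+1%:R / e%:R.
  by rewrite -addSn natrD; field.
exact: vA.
Qed.

Lemma has_symbol_sum r m (A : 'I_m -> series -> series) :
    (forall i, has_symbol r (fun=> fun=> 0) (A i)) ->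
  has_symbol r (fun=> fun=> 0) (fun f => \sum_(i < m) A i f).
Proof.
move=> hA mu f vf; split=> [l|]; rewrite fct_sumE big1 // => i _.
  by have [-> ] := hA i mu f vf.
by have [_ ->] := hA i mu f vf.
Qed.

(** Multiplication by z^s g(z^(-1/e)). *)
Definition mulpoly (s : C) g f : series :=
  fun mu k => \sum_(j < size g) g`_j * f (mu - s + j%:R / e%:R) k.

Lemma mulpoly_wide N s g f mu k :
  (size g <= N)%N ->
  mulpoly s g f mu k = \sum_(j < N) g`_j * f (mu - s + j%:R / e%:R) k.
Proof.
move=> leN; rewrite /mulpoly (big_ord_widen N
  (fun j : nat => g`_j * f (mu - s + j%:R / e%:R) k)) // big_mkcond.
by apply: eq_bigr => j _; case: ltnP => // /(nth_default 0) ->; rewrite mul0r.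
Qed.

Lemma mulpolyD s g g' f : mulpoly s (g + g') f = mulpoly s g f + mulpoly s g' f.
Proof.
apply/funext=> mu; apply/funext=> k; rewrite !fctE.
pose N := (size g + size g')%N.
rewrite !(@mulpoly_wide N) ?leq_addr ?leq_addl //; last first.
  by rewrite (leq_trans (size_polyD _ _)) // geq_max leq_addr leq_addl.
by rewrite -big_split; apply: eq_bigr => j _; rewrite coefD mulrDl.
Qed.

Lemma mulpolyZ s c g f : mulpoly s (c *: g) f = c *: mulpoly s g f.
Proof.
apply/funext=> mu; apply/funext=> k.
rewrite -[RHS]/(c *: mulpoly s g f mu k).
rewrite (@mulpoly_wide (size g)) ?size_scale_leq // scaler_sumr.
by apply: eq_bigr => j _; rewrite coefZ -mulrA.
Qed.

Lemma mulpoly0 s f : mulpoly s 0 f = 0.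
Proof. by apply/funext=> mu; apply/funext=> k; rewrite /mulpoly size_poly0 big_ord0. Qed.

Lemma mulpolyX s g f mu : mulpoly s (g * 'X) f mu = mulpoly s g f (mu + e%:R^-1).
Proof.
apply/funext=> k; rewrite (@mulpoly_wide (size g).+1); last first.
  have [->|g_neq0] := eqVneq g 0; first by rewrite mul0r size_poly0.
  by rewrite size_mulX.
rewrite big_ord_recl coefMX eqxx mul0r add0r; apply: eq_bigr => j _.
rewrite coefMX /=; congr (_ * f _ k); rewrite /bump /= add1n -natr1; field.
exact: e_neq0.
Qed.

Lemma mulpolyXn s g (l : nat) f mu :
  mulpoly s (g * 'X^l) f mu = mulpoly s g f (mu + l%:R / e%:R).
Proof.
elim: l mu => [|l IH] mu; first by rewrite mulr1 mul0r addr0.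
by rewrite exprSr mulrA mulpolyX IH -natr1; congr (mulpoly _ _ _ _); field.
Qed.

Lemma mulpolyC s c f mu k : mulpoly s c%:P f mu k = c * f (mu - s) k.
Proof.
rewrite (@mulpoly_wide 1) ?size_polyC ?leq_b1 // big_ord1 coefC eqxx.
by rewrite mul0r addr0.
Qed.

Lemma mulpoly_shift s s' g f (l : nat) :
  s' = s + l%:R -> mulpoly s g f = mulpoly s' (g * 'X^(l * e)) f.
Proof.
move=> ->; apply/funext=> mu; rewrite mulpolyXn /mulpoly; apply/funext => k.
apply: eq_bigr => j _; congr (_ * f _ k).
by rewrite natrM; field.
Qed.

Lemma mulpoly_comp s t g g' f :
  mulpoly s g (mulpoly t g' f) = mulpoly (s + t) (g * g') f.
Proof.
elim/poly_ind: g => [|g c IH]; first by rewrite mul0r !mulpoly0.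
rewrite mulpolyD mulrDl mulpolyD -mulrA [_ * g']mulrC mulrA mul_polyC mulpolyZ.
apply/funext=> mu; rewrite !fctE !mulpolyX IH; apply/funext=> k; congr (_ + _).
rewrite mulpolyC; congr (c * _); apply: eq_bigr => j _; congr (_ * f _ k).
by rewrite opprD addrA.
Qed.

Lemma has_symbol_mulpoly (s : C) g (j : nat) :
  (size g <= j.+1)%N ->
  has_symbol (j%:R / e%:R - s) (fun=> fun h => g`_j *: h) (mulpoly s g).
Proof.
move=> leg mu f vf; split=> [l|]; apply/funext=> k; rewrite (mulpoly_wide _ _ _ _ leg).
  apply: big1 => i _.
  suff -> : mu - (j%:R / e%:R - s) - l.+1%:R / e%:R - s + i%:R / e%:R =
      mu - (l + (j - i)).+1%:R / e%:R by rewrite vf mulr0.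
  have leij : (i <= j)%N by rewrite -ltnS.
  by rewrite -addSn natrD natrB //; field.
rewrite big_ord_recr big1 /= ?add0r => [|i _].
  by congr (_ * f _ k); field.
suff -> : mu - (j%:R / e%:R - s) - s + i%:R / e%:R =
    mu - (j - i.+1).+1%:R / e%:R by rewrite vf mulr0.
have leij : (i <= j)%N by rewrite ltnW.
by rewrite -subSn // subSS natrB //; field.
Qed.

(** The operator z^2 d/dz, which is - d/dx. *)
Definition z2_deriv f : series :=
  fun mu k => (mu - 1) * f (mu - 1) k + k.+1%:R * f (mu - 1) k.+1.

(** Differentiation with respect to log z. *)
Definition log_shift h : coef := fun k => k.+1%:R * h k.+1.

Lemma has_symbol_z2_deriv : has_symbol (- 1) (fun mu h => mu *: h + log_shift h) z2_deriv.
Proof.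
move=> mu f vf; split=> [l|]; apply/funext=> k; rewrite /z2_deriv.
  rewrite opprK (_ : _ - 1 = mu - l.+1%:R / e%:R) ?vf ?mulr0 ?addr0 //.
  by field.
by rewrite opprK addrK.
Qed.

(** The derivation d/dx conjugated by an exponential exp P, where g is chosen so
    that z g(z^(-1/e)) = dP/dx. *)
Definition ddx g f : series := mulpoly 1 g f - z2_deriv f.

(** With y = dP/dx, this is (d/dx + y)^i - y^i: what remains of the conjugated
    operator once derivatives are neglected. *)
Definition ddx_rem g i f : series := iter i (ddx g) f - mulpoly i%:R (g ^+ i) f.

Lemma ddx_linear g (c : C) f f' : ddx g (c *: f + f') = c *: ddx g f + ddx g f'.
Proof.
apply/funext=> mu; apply/funext => k.
rewrite -[LHS]/(mulpoly 1 g (c *: f + f') mu k - z2_deriv (c *: f + f') mu k).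
rewrite -[RHS]/(c * (mulpoly 1 g f mu k - z2_deriv f mu k)
  + (mulpoly 1 g f' mu k - z2_deriv f' mu k)).
have -> : mulpoly 1 g (c *: f + f') mu k = c * mulpoly 1 g f mu k + mulpoly 1 g f' mu k.
  rewrite mulr_sumr -big_split; apply: eq_bigr => j _.
  rewrite -[(c *: f + f') _ _]/(c * f _ _ + f' _ _) /= mulrDr.
  by congr (_ + _); rewrite mulrCA.
have -> : z2_deriv (c *: f + f') mu k = c * z2_deriv f mu k + z2_deriv f' mu k.
  rewrite /z2_deriv -[(c *: f + f') _ _]/(c * f _ _ + f' _ _).
  by rewrite -[(c *: f + f') _ k.+1]/(c * f _ _ + f' _ _); ring.
by ring.
Qed.

Lemma ddxB g f f' : ddx g (f - f') = ddx g f - ddx g f'.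
Proof. by rewrite addrC -scaleN1r ddx_linear scaleN1r addrC. Qed.

(** Telescoping: writing D = y - E with E = z^2 d/dz, one has
    D^(i+1) - y^(i+1) = D (D^i - y^i) - E y^i. *)
Lemma ddx_remS g i f :
  ddx_rem g i.+1 f = ddx g (ddx_rem g i f) - z2_deriv (mulpoly i%:R (g ^+ i) f).
Proof.
rewrite /ddx_rem ddxB iterS exprS -[in i.+1%:R]addn1 natrD [_ + 1]addrC.
rewrite -mulpoly_comp; move: (iter _ _ f) (mulpoly i%:R _ f) => u w.
have -> : mulpoly 1 g w = ddx g w + z2_deriv w by rewrite /ddx addrNK.
by move: (ddx g u) (ddx g w) => x y; rewrite opprD addrA.
Qed.

Lemma has_symbol_ddx g (j : nat) :
    (0 < j)%N -> (size g <= j.+1)%N ->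
  has_symbol (j%:R / e%:R - 1) (fun=> fun h => g`_j *: h) (ddx g).
Proof.
move=> j_gt0 leg.
have := has_symbolZ (-1) (has_symbol_raise j_gt0 has_symbol_z2_deriv).
rewrite addrC => hE.
apply: has_symbol_ext (has_symbolD (has_symbol_mulpoly 1 leg) hE) => // [mu h|f].
  by rewrite scaler0 addr0.
by rewrite scaleN1r.
Qed.

Lemma has_symbol_iter_ddx g (j i : nat) :
    (0 < j)%N -> (size g <= j.+1)%N ->
  has_symbol ((j%:R / e%:R - 1) * i%:R) (fun=> fun h => g`_j ^+ i *: h) (iter i (ddx g)).
Proof.
move=> j_gt0 leg; elim: i => [|i IH].
  move=> mu f vf; rewrite mulr0 subr0; split=> //.
  by rewrite expr0 scale1r.
apply: has_symbol_ext (has_symbol_comp (has_symbol_ddx j_gt0 leg) IH) => // [|mu h].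
  by rewrite -natr1; ring.
by rewrite scalerA -exprS.
Qed.

Variable (q : nat).

Lemma scaler_log_shift c h : log_shift (c *: h) = c *: log_shift h.
Proof.
by apply/funext=> k; rewrite /log_shift -[RHS]/(c * (k.+1%:R * h k.+1)) mulrCA.
Qed.

(** For y of order q with leading coefficient c, the correction D^i - y^i has order
    q (i - 1) - 1 only, and its symbol involves the exponent mu linearly. The
    term in 'C(i, 2) comes from E acting on the powers x^(q j), j < i. *)
Lemma has_symbol_ddx_rem g (i : nat) :
  (size g <= (q.+1 * e).+1)%N ->
  has_symbol (q%:R * i%:R - 1)
    (fun mu h => - g`_(q.+1 * e) ^+ i *:
       ((i.+1%:R * mu - q%:R * 'C(i.+1, 2)%:R) *: h + i.+1%:R *: log_shift h))
    (ddx_rem g i.+1).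
Proof.
move=> leg; set c := g`_ _.
have qe_gt0 : (0 < q.+1 * e)%N by rewrite muln_gt0 e_gt0.
have hD := has_symbol_ddx qe_gt0 leg; rewrite -/c in hD.
have qeE : (q.+1 * e)%:R / e%:R - 1 = q%:R :> C.
  by rewrite natrM mulfK // -natr1 addrK.
rewrite qeE in hD.
elim: i => [|i IH].
  apply: has_symbol_ext (has_symbolN has_symbol_z2_deriv) => [|mu h|f].
  - by rewrite mulr0 add0r.
  - by rewrite expr0 bin_small // mulr0 subr0 mul1r scale1r scaleN1r.
  - rewrite /ddx_rem expr1 -[iter _ _ _]/(mulpoly 1 g f - z2_deriv f).
    by move: (mulpoly _ _ f) (z2_deriv f) => x y; rewrite addrAC subrr add0r.
have hY : has_symbol (q%:R * i.+1%:R) (fun=> fun h => c ^+ i.+1 *: h)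
    (mulpoly i.+1%:R (g ^+ i.+1)).
  apply: has_symbol_ext (has_symbol_mulpoly i.+1%:R (size_exp_leqS i.+1 leg)) => //.
    by rewrite !natrM -[q.+1%:R]natr1; field.
  by move=> _ h; rewrite coef_exp_top.
have hDH := has_symbol_comp hD IH.
have hEY := has_symbolN (has_symbol_comp has_symbol_z2_deriv hY).
have ord1 : q%:R + (q%:R * i%:R - 1) = q%:R * i.+1%:R - 1 :> C by rewrite -natr1; ring.
have ord2 : - 1 + q%:R * i.+1%:R = q%:R * i.+1%:R - 1 :> C by rewrite addrC.
rewrite ord1 in hDH; rewrite ord2 in hEY.
apply: has_symbol_ext (has_symbolD hDH hEY) => // [mu h|f]; last by rewrite [RHS]ddx_remS.
apply/funext=> k; rewrite scaler_log_shift.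
rewrite -[LHS]/(c * (- c ^+ i * ((i.+1%:R * mu - q%:R * 'C(i.+1, 2)%:R) * h k
   + i.+1%:R * log_shift h k)) - ((mu - q%:R * i.+1%:R) * (c ^+ i.+1 * h k)
   + c ^+ i.+1 * log_shift h k)).
rewrite -[RHS]/(- c ^+ i.+1 * ((i.+2%:R * mu - q%:R * 'C(i.+2, 2)%:R) * h k
   + i.+2%:R * log_shift h k)).
rewrite [in RHS]binS bin1 natrD exprS -[in i.+2%:R]natr1.
ring.
Qed.
End Symbols.

(** * Kernels of operators with a given symbol *)

Section Kernels.
Variables (C : numFieldType) (e : nat).
Hypothesis e_gt0 : (0 < e)%N.

Local Notation coef := (nat -> C^o).
Local Notation series := (C -> nat -> C^o).

Implicit Types (f : series) (h : coef) (A : series -> series).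
Implicit Types (phi : C -> coef -> coef).

Let e_neq0 : e%:R != 0 :> C.
Proof. by rewrite pnatr_eq0 -lt0n. Qed.

(** What a component of a formal solution satisfies: powers of log z are bounded,
    and on each coset of Z/e the exponents are bounded below. *)
Definition bounded_support f :=
  (exists K, forall mu k, (K <= k)%N -> f mu k = 0) /\
  (forall mu, exists L, forall l, (L <= l)%N -> f (mu - l%:R / e%:R) = 0).

Lemma bounded_linear (c : C) f f' :
  bounded_support f -> bounded_support f' -> bounded_support (c *: f + f').
Proof.
move=> [[K fK] fL] [[K' fK'] fL']; split.
  exists (maxn K K') => mu k; rewrite geq_max => /andP[leK leK'].
  by rewrite -[LHS]/(c * f mu k + f' mu k) fK // fK' // mulr0 addr0.
move=> mu; have [L {}fL] := fL mu; have [L' {}fL'] := fL' mu.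
exists (maxn L L') => l; rewrite geq_max => /andP[leL leL'].
apply/funext=> k.
by rewrite -[LHS]/(c * f _ k + f' _ k) fL // fL' // mulr0 addr0.
Qed.

Lemma bounded0 : bounded_support 0.
Proof. by split; [exists 0%N | exists 0%N]. Qed.

Lemma bounded_sum (I : Type) (r : seq I) (F : I -> series) :
  (forall i, bounded_support (F i)) -> bounded_support (\sum_(i <- r) F i).
Proof.
move=> bF; elim: r => [|i r IH]; first by rewrite big_nil; exact: bounded0.
by rewrite big_cons -[F i]scale1r; exact: bounded_linear.
Qed.

Lemma lowest_term f :
  bounded_support f -> f <> 0 -> exists2 mu, f mu <> 0 & vanish_below e mu f.
Proof.
move=> [_ fL] f_neq0.
have [mu fmu] : exists mu, f mu <> 0.
  by apply/not_existsP => f0; apply: f_neq0; apply/funext=> mu; exact: contrapT (f0 mu).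
have [L {}fL] := fL mu.
have exP : exists l : nat, f (mu - l%:R / e%:R) != 0.
  by exists 0%N; rewrite mul0r subr0; exact/eqP.
have ubP (l : nat) : f (mu - l%:R / e%:R) != 0 -> (l <= L)%N.
  by move/eqP=> fl; rewrite leqNgt; apply/negP=> /ltnW /fL.
case: (ex_maxnP exP ubP) => l /eqP fl max_l.
exists (mu - l%:R / e%:R) => // j.
have -> : mu - l%:R / e%:R - j.+1%:R / e%:R = mu - (l + j.+1)%:R / e%:R.
  by rewrite natrD; field.
apply: contraTeq isT => /max_l; lia.
Qed.

(** The lowest term of a solution is killed by the symbol (indicial equation). *)
Lemma kernel_lowest r phi A f :
    has_symbol e r phi A -> bounded_support f -> f <> 0 -> A f = 0 ->
  exists2 mu, f mu <> 0 & phi mu (f mu) = 0.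
Proof.
move=> hA bf /(lowest_term bf)[mu fmu vf] Af0; exists mu => //.
by have [_ <-] := hA mu f vf; rewrite Af0.
Qed.

(** An operator with an invertible constant symbol has no nonzero solutions: this
    is the tool which excludes all wrong exponentials. *)
Lemma kernel_scalar r (c : C) A f :
    has_symbol e r (fun=> fun h => c *: h) A -> bounded_support f -> f <> 0 -> A f = 0 ->
  c = 0.
Proof.
move=> hA bf f_neq0 Af0; have [mu fmu /eqP] := kernel_lowest hA bf f_neq0 Af0.
by rewrite scaler_eq0 => /orP[/eqP //|/eqP].
Qed.

(** Differentiation with respect to log z is nilpotent on polynomials in log z, so
    that adding it to a nonzero scalar gives an invertible operator. *)
Lemma kernel_log_shift (c : C) h (K : nat) :
    (forall k, (K <= k)%N -> h k = 0) -> c *: h + log_shift h = 0 -> h <> 0 ->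
  c = 0 /\ forall k, h k.+1 = 0.
Proof.
move=> hK eq0 h_neq0.
have eqk k : c * h k + k.+1%:R * h k.+1 = 0 by rewrite -[LHS]/((c *: h + log_shift h) k) eq0.
have c0 : c = 0.
  apply: contrapT => /eqP c_neq0; apply: h_neq0.
  suff h0 j : forall k, (K <= k + j)%N -> h k = 0.
    by apply/funext=> k; apply: (h0 K); rewrite leq_addl.
  elim: j => [|j IH] k lek; first by rewrite hK // -(addn0 k).
  have := eqk k; rewrite [h k.+1]IH ?addSnnS // mulr0 addr0 => /eqP.
  by rewrite mulf_eq0 (negPf c_neq0) => /eqP.
split=> // k; have /eqP := eqk k.
by rewrite c0 mul0r add0r mulf_eq0 pnatr_eq0 => /eqP.
Qed.

(** The series z^lambda v of a formal solution, v having the coefficients of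
    (log z)^k z^(l/e) listed in [nth _ v k l]. *)
Definition log_series (lambda : C) (v : seq (nat -> C)) : series :=
  fun mu k =>
    \sum_(l \in [set l : nat | lambda + l%:R / e%:R = mu]%classic)
      nth (fun=> 0) v k l.

Lemma log_series_off lambda v mu :
  (forall l : nat, lambda + l%:R / e%:R <> mu) -> log_series lambda v mu = 0.
Proof.
move=> off; apply/funext=> k; rewrite /log_series.
rewrite (_ : [set _ | _]%classic = set0) ?fsbig_set0 //.
by apply/seteqP; split=> // l /off.
Qed.

Lemma shift_inj (lambda : C) (l l' : nat) :
  lambda + l%:R / e%:R = lambda + l'%:R / e%:R -> l = l'.
Proof.
move/addrI/(mulIf (invr_neq0 e_neq0))/eqP.
by rewrite eqr_nat => /eqP.
Qed.

Lemma log_series_on lambda v (l k : nat) :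
  log_series lambda v (lambda + l%:R / e%:R) k = nth (fun=> 0) v k l.
Proof.
rewrite /log_series (_ : [set _ | _]%classic = [set l]%classic) ?fsbig_set1 //.
by apply/seteqP; split=> [l' /shift_inj ->|l' ->].
Qed.

Lemma bounded_log_series lambda v : bounded_support (log_series lambda v).
Proof.
split.
  exists (size v) => mu k lek; rewrite /log_series nth_default //.
  by rewrite fsbig1.
move=> mu.
have [[l0 [j0 eq0]]|none] := pselect (exists l0 j0 : nat,
  lambda + j0%:R / e%:R = mu - l0%:R / e%:R).
  exists (l0 + j0).+1 => l lel; apply: log_series_off => j eqj.
  have : lambda + (j0 + l0)%:R / e%:R = lambda + (j + l)%:R / e%:R.
    by rewrite !natrD !mulrDl !addrA eq0 eqj !subrK.
  by move/shift_inj; lia.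
by exists 0%N => l _; apply: log_series_off => j eqj; apply: none; exists l, j.
Qed.

(** Operators with symbol kappa (mu - lambda + d/d(log z)): the indicial equation has
    the single root lambda, hence up to a constant a single solution, which is
    free of logarithms. *)
Section OneDimensional.
Variables (A : series -> series) (r kappa lambda : C).
Hypothesis A_linear : forall (c : C) f f', A (c *: f + f') = c *: A f + A f'.
Hypothesis kappa_neq0 : kappa != 0.
Hypothesis A_symbol : has_symbol e r
  (fun mu h => kappa *: ((mu - lambda) *: h + log_shift h)) A.
Hypothesis A_log_free : forall f,
  (forall mu k, f mu k.+1 = 0) -> forall mu k, A f mu k.+1 = 0.

Let ser (s : nat -> C) := log_series lambda [:: s].

Let ser_on s l k : ser s (lambda + l%:R / e%:R) k = if k is 0%N then s l else 0.
Proof. by rewrite /ser log_series_on; case: k => // k; rewrite nth_default. Qed.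

Let ser_log_free s mu k : ser s mu k.+1 = 0.
Proof. by rewrite /ser /log_series nth_default //= fsbig1. Qed.

Let ser_off s mu k :
  (forall l : nat, lambda + l%:R / e%:R <> mu) -> ser s mu k = 0.
Proof. by move=> off; rewrite /ser log_series_off. Qed.

Let ser_linear (c : C) s s' : ser (fun l => c * s l + s' l) = c *: ser s + ser s'.
Proof.
apply/funext=> mu; apply/funext=> k; rewrite -[RHS]/(c * ser s mu k + ser s' mu k).
have [[l <-]|off] := pselect (exists l : nat, lambda + l%:R / e%:R = mu).
  by rewrite !ser_on; case: k => // k; rewrite mulr0 addr0.
have {}off l : lambda + l%:R / e%:R <> mu by move=> eql; apply: off; exists l.
by rewrite !ser_off // mulr0 addr0.
Qed.

(** A perturbation of the series from z^(lambda + j/e) on changes the residual at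
    the corresponding exponent by the factor kappa j/e, nonzero for j > 0. *)
Lemma image_leading s j :
    (forall i, (i < j)%N -> s i = 0) ->
  A (ser s) (lambda + j%:R / e%:R - r) 0%N = kappa * (j%:R / e%:R * s j).
Proof.
move=> s0; have vs : vanish_below e (lambda + j%:R / e%:R) (ser s).
  move=> l; apply/funext=> k.
  have [[i eqi]|off] := pselect (exists i : nat,
      lambda + i%:R / e%:R = lambda + j%:R / e%:R - l.+1%:R / e%:R).
    have eqj : j = (i + l.+1)%N.
      by apply: (@shift_inj lambda); rewrite natrD mulrDl addrA eqi subrK.
    by rewrite -eqi ser_on s0 ?eqj ?addnS ?ltnS ?leq_addr //; case: k.
  by rewrite ser_off // => i eqi; apply: off; exists i.
have [_ ->] := A_symbol vs.
rewrite -[LHS]/(kappa * ((lambda + j%:R / e%:R - lambda) * ser s (lambda + j%:R / e%:R) 0%N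
  + 1 * ser s (lambda + j%:R / e%:R) 1%N)) !ser_on.
by rewrite mulr0 addr0 addrAC subrr add0r.
Qed.

(** The coefficients are determined one after the other, each cancelling the next
    term of the residual. *)
Lemma exists_solution : exists2 v : nat -> C, v 0%N = 1 & A (ser v) = 0.
Proof.
(* The coefficient that extends the partial solution s by one term. *)
pose next (s : seq C) : C := let l := (size s)%:R / e%:R in
  - A (ser (nth 0 s)) (lambda + l - r) 0%N / (kappa * l).
pose s := fix s l : seq C := if l is l'.+1 then rcons (s l') (next (s l')) else [:: 1].
have size_s l : size (s l) = l.+1 by elim: l => //= l IH; rewrite size_rcons IH.
pose v l := nth 0 (s l) l.
have sE l j : nth 0 (s l) j = if (j <= l)%N then v j else 0.
  elim: l => [|l IH].
    by case: j => // j; rewrite nth_default.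
  rewrite /= nth_rcons size_s ltnS; case: (ltngtP j l.+1) => [ltjl|ltlj|->].
  - by rewrite -ltnS ltjl IH -ltnS ltjl.
  - by rewrite leqNgt (ltnW ltlj).
  - by rewrite ltnn /v /= nth_rcons size_s ltnn eqxx.
exists v => //; apply/funext=> mu'; apply/funext=> k.
case: k => [|k]; last by apply: A_log_free => ? ?; exact: ser_log_free.
pose mu := mu' + r; have -> : mu' = mu - r by rewrite addrK.
have [[l <-]|off] := pselect (exists l : nat, lambda + l%:R / e%:R = mu); last first.
  have vm l : ser v (mu - l%:R / e%:R) = 0.
    apply: log_series_off => j eqj; apply: off; exists (j + l)%N.
    by rewrite natrD mulrDl addrA eqj subrK.
  have [_ ->] := A_symbol (fun l => vm l.+1).
  have -> : ser v mu = 0 by rewrite -(vm 0%N) mul0r subr0.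
  by rewrite -[LHS]/(kappa * ((mu - lambda) * 0 + 1 * 0)) !mulr0 addr0 mulr0.
(* Split v into the first l + 1 terms and a tail, which starts at l + 1. *)
case: l => [|l]; first by rewrite image_leading // !mul0r mulr0.
pose w j := v j - nth 0 (s l) j.
have -> : v = (fun j => 1 * w j + nth 0 (s l) j).
  by apply/funext=> j; rewrite /w mul1r subrK.
rewrite ser_linear A_linear.
rewrite -[LHS]/(1 * A (ser w) (lambda + l.+1%:R / e%:R - r) 0%N +
  A (ser (nth 0 (s l))) (lambda + l.+1%:R / e%:R - r) 0%N).
rewrite image_leading => [|i lti]; last by rewrite /w sE -ltnS lti subrr.
rewrite /w sE ltnn subr0 /v /= nth_rcons size_s ltnn eqxx /next size_s.
rewrite -[(0 : series) _ _]/(0 : C).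
by field; rewrite e_neq0 kappa_neq0 nat1r pnatr_eq0.
Qed.

(** Subtracting the multiple of the known solution that has the same term in
    z^lambda leaves a solution whose lowest term has no possible exponent. *)
Lemma kernel_dim1 v f : v 0%N = 1 -> A (ser v) = 0 ->
  bounded_support f -> A f = 0 -> exists c : C, f = c *: ser v.
Proof.
move=> v0 Av0 bf Af0; exists (f lambda 0%N).
pose d := (- f lambda 0%N) *: ser v + f.
have bd : bounded_support d by apply: bounded_linear => //; exact: bounded_log_series.
have Ad : A d = 0 by rewrite /d A_linear Av0 scaler0 Af0 addr0.
suff d0 : d = 0 by rewrite -[LHS](addKr (- f lambda 0%N *: ser v)) -/d d0 addr0 scaleNr opprK.
apply: contrapT => d_neq0.
have [mu dmu] := kernel_lowest A_symbol bd d_neq0 Ad.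
move/eqP; rewrite scaler_eq0 (negPf kappa_neq0) /= => /eqP eq0.
have [[K dK] _] := bd.
have [/eqP] := kernel_log_shift (dK mu) eq0 dmu.
rewrite subr_eq0 => /eqP mu_eq dS; apply: dmu; apply/funext=> -[|k] //.
rewrite mu_eq -[LHS]/(- f lambda 0%N * ser v lambda 0%N + f lambda 0%N).
by have := ser_on v 0 0; rewrite mul0r addr0 => ->; rewrite v0 mulr1 addNr.
Qed.
End OneDimensional.
End Kernels.

(** * The polynomial equation of the exponents *)

Section AiryPoly.
Variables (K : comNzRingType) (n q : nat) (a b : nat -> K).

(** For y = z Y(z^(-1/e)), this is sum_i a_i y^i - sum_j b_j x^j up to the factor
    z^n, in the variable z^(-1/e): the equation that y = dP/dx would satisfy if
    derivatives of y were neglected. *)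
Definition airy_poly (e : nat) (Y : {poly K}) : {poly K} :=
  \sum_(i < n.+1) a i *: (Y ^+ i * 'X^((n - i) * e))
  - \sum_(j < (q * n).+1) b j *: 'X^((j + n) * e).

(** When y is a polynomial in 1/z, the equation does not depend on the ramification. *)
Lemma airy_poly_comp e Y : airy_poly e (Y \Po 'X^e) = airy_poly 1 Y \Po 'X^e.
Proof.
rewrite /airy_poly linearB /= [in RHS]raddf_sum [X in _ = _ - X]raddf_sum /=.
congr (_ - _); apply: eq_bigr => i _.
  rewrite linearZ /= comp_polyM rmorphXn /= comp_Xn_poly muln1.
  by rewrite -exprM mulnC.
by rewrite linearZ /= comp_Xn_poly muln1 -exprM [(e * _)%N]mulnC.
Qed.

Variable alpha : 'I_q.+1 -> K.
Let P : {poly K} := \sum_(j < q.+1) alpha j *: 'X^j.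

Definition reversal : {poly K} := \sum_(j < q.+1) alpha j *: 'X^(q.+1 - j).

Lemma size_reversal : (size reversal <= q.+2)%N.
Proof.
apply: (leq_trans (size_sum _ _ _)); apply/bigmax_leqP => j _.
by rewrite (leq_trans (size_scale_leq _ _)) // size_polyXn ltnS leq_subr.
Qed.

(** Passing from z to 1/z reverses the coefficients of a polynomial, and reversal
    commutes with powers. *)
Lemma coef_reversal_exp i M s :
  (M + s = q.+1 * i)%N -> (reversal ^+ i)`_M = (P ^+ i)`_s.
Proof.
have leP : (size P <= q.+1)%N.
  apply: (leq_trans (size_sum _ _ _)); apply/bigmax_leqP => j _.
  by rewrite (leq_trans (size_scale_leq _ _)) // size_polyXn.
elim: i M s => [|i IH] M s eqMs.
  by rewrite !expr0; have [-> ->] : M = 0%N /\ s = 0%N by lia.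
have leRi := size_exp_leqS i size_reversal.
have lePi := size_exp_leqS i leP.
rewrite !exprSr [in LHS]/reversal [in RHS]/P !mulr_sumr !coef_sum.
apply: eq_bigr => j _; rewrite -!scalerAr !coefZ; congr (_ * _).
have lej := ltn_ord j; rewrite !coefMXn.
case: ltnP => ltM; case: ltnP => lts //.
- by rewrite nth_default // (leq_trans lePi) //; nia.
- by rewrite nth_default // (leq_trans leRi) //; nia.
- by apply: IH; nia.
Qed.

(** The system (A) says precisely that the q + 1 leading coefficients of the
    equation vanish for y = - (alpha_0 x^q + ... + alpha_q). The coefficient
    a_(n-1) enters only the last of them because y^(n-1) has degree q less than
    y^n, and y^i with i < n - 1 has too small a degree to enter at all. *)
Lemma size_airy_poly_reversal n' :
    (0 < q)%N -> n = n'.+1 -> a n = 1 ->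
    (forall s, (s < q)%N -> (P ^+ n)`_s = (-1) ^+ n * b (q * n - s)%N) ->
    (P ^+ n)`_q = a n' * (P ^+ n')`_0 + (-1) ^+ n * b (q * n - q)%N ->
  (size (airy_poly 1 (- reversal)) <= (q.+1 * n').+1)%N.
Proof.
move=> q_gt0 n_eq an sysA sysA_q; apply/leq_sizeP => N ltN.
have signK m (x : K) : (-1) ^+ m * ((-1) ^+ m * x) = x.
  by rewrite mulrA -exprD addnn -mul2n exprM sqrrN !expr1n mul1r.
have coefT i : ((- reversal) ^+ i * 'X^((n - i) * 1))`_N =
    if (N < n - i)%N then 0 else (-1) ^+ i * (reversal ^+ i)`_(N - (n - i)).
  rewrite muln1 coefMXn [(- reversal) ^+ i]exprNn.
  have -> : (-1) ^+ i = ((-1) ^+ i)%:P :> {poly K} by rewrite polyC_exp polyCN.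
  by rewrite mul_polyC coefZ.
rewrite /airy_poly coefB !coef_sum.
have -> : \sum_(j < (q * n).+1) (b j *: 'X^((j + n) * 1))`_N =
    if (N <= q.+1 * n)%N then b (N - n)%N else 0.
  have leN : (n <= N)%N by nia.
  case: ifP => [leNq|gtNq].
    have ltNn : (N - n < (q * n).+1)%N by lia.
    rewrite (bigD1 (Ordinal ltNn)) //= big1 => [|j /eqP neq_j].
      by rewrite coefZ coefXn muln1 subnK // eqxx mulr1 addr0.
    rewrite coefZ coefXn muln1; case: eqP => [N_eq|_]; last by rewrite mulr0.
    by case: neq_j; apply: val_inj; rewrite /= N_eq addnK.
  apply: big1 => j _; rewrite coefZ coefXn muln1.
  case: eqP => [N_eq|_]; last by rewrite mulr0.
  by have := ltn_ord j; lia.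
rewrite n_eq !big_ord_recr /= big1 => [|i _]; last first.
  rewrite coefZ -n_eq coefT; case: ltnP; rewrite ?mulr0 // => leN.
  rewrite nth_default ?mulr0 // (leq_trans (size_exp_leqS i size_reversal)) //.
  have lti := ltn_ord i; have : (q * i.+1 <= q * n')%N by rewrite leq_mul2l lti orbT.
  by nia.
rewrite -n_eq !coefZ !coefT an subnn subn0 add0r mul1r.
have -> : (n - n' = 1)%N by lia.
case: ltnP => [|lt0N]; first lia.
have [leN|gtN] := leqP N (q.+1 * n); last first.
  rewrite !nth_default ?mulr0 ?addr0 ?subr0 //.
    by rewrite (leq_trans (size_exp_leqS n size_reversal)).
  by rewrite (leq_trans (size_exp_leqS n' size_reversal)) //; nia.
have [s eq_s] : exists s, (N + s = q.+1 * n)%N by exists (q.+1 * n - N)%N; lia.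
have qn : (q.+1 * n = q.+1 * n' + q.+1)%N by rewrite n_eq mulnS addnC.
have leq_s : (s <= q)%N by lia.
rewrite (coef_reversal_exp eq_s) (_ : N - n = q * n - s)%N; last by lia.
move: leq_s; rewrite leq_eqVlt => /predU1P[sq|lts].
  rewrite (@coef_reversal_exp n' (N - 1) 0); last by lia.
  by rewrite sq sysA_q mulrDr signK n_eq exprS; ring.
rewrite nth_default; last first.
  by rewrite (leq_trans (size_exp_leqS n' size_reversal)) //; lia.
by rewrite sysA // signK !mulr0 add0r subrr.
Qed.
End AiryPoly.

Section PowerRoots.
Variable K : numFieldType.

(** First order effect of a perturbation of P in degree s + 1. *)
Lemma exp_perturb (P : {poly K}) (d : K) (s n : nat) :
  exists Q : {poly K}, (P + d *: 'X^(s.+1)) ^+ n.+1 =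
    P ^+ n.+1 + (n.+1%:R * d) *: (P ^+ n * 'X^(s.+1)) + Q * 'X^(s.+2).
Proof.
elim: n => [|n [Q eqQ]].
  by exists 0; rewrite !expr1 expr0 mul1r mul0r addr0 mul1r.
exists (P * Q + (n.+1%:R * d ^+ 2) *: (P ^+ n * 'X^s) + d *: (Q * 'X^(s.+1))).
rewrite exprS eqQ -!mul_polyC !exprS -[n.+2%:R]natr1 !(polyCM, polyCD).
ring.
Qed.

(** An n-th root of a power series, up to any order: as P`_0 is a nonzero constant,
    the linear effect of the coefficient P`_s on the coefficient of degree s of
    P ^+ n is invertible. *)
Lemma exists_power_root (n q : nat) (c : K) (t : nat -> K) :
    (0 < n)%N -> c != 0 -> c ^+ n = t 0%N ->
  exists P : {poly K}, [/\ (size P <= q.+1)%N, P`_0 = c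
    & forall s, (s <= q)%N -> (P ^+ n)`_s = t s].
Proof.
case: n => // n _ c_neq0 cn; elim: q => [|q [P [leP P0 Pt]]].
  exists c%:P; rewrite size_polyC leq_b1 coefC eqxx; split=> // s.
  by rewrite leqn0 => /eqP ->; rewrite -polyC_exp coefC.
pose d := (t q.+1 - (P ^+ n.+1)`_q.+1) / (n.+1%:R * c ^+ n).
have [Q eqQ] := exp_perturb P d q n.
exists (P + d *: 'X^(q.+1)); split.
- rewrite (leq_trans (size_polyD _ _)) // geq_max leqW //=.
  by rewrite (leq_trans (size_scale_leq _ _)) // size_polyXn.
- by rewrite coefD coefZ coefXn mulr0 addr0.
- move=> s les; rewrite eqQ !coefD coefZ !coefMXn (ltnS s q.+1) les addr0.
  have := les; rewrite leq_eqVlt => /predU1P[->|lts]; last first.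
    by rewrite lts mulr0 addr0 Pt.
  have Pn0 : (P ^+ n)`_0 = c ^+ n by rewrite -horner_coef0 horner_exp horner_coef0 P0.
  rewrite ltnn subnn Pn0 /d.
  by field; rewrite expf_neq0 //= nat1r pnatr_eq0.
Qed.
End PowerRoots.

Lemma exists_roots (K : numClosedFieldType) (n : nat) (w : K) :
    (0 < n)%N -> w != 0 ->
  exists r : 'I_n -> K, injective r /\ forall x, x ^+ n = w <-> exists i, r i = x.
Proof.
move=> n_gt0 w_neq0; pose p : {poly K} := 'X^n - w%:P.
have [rs] := closed_field_poly_normal p.
rewrite lead_coefXnsubC // scale1r => p_eq.
have size_rs : size rs == n.
  by rewrite -eqSS -(size_prod_XsubC rs id) -p_eq size_XnsubC.
have uniq_rs : uniq rs.
  rewrite -separable_prod_XsubC -p_eq unlock; apply/Bezout_eq1_coprimepP.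
  (* The constant n w is 'X p' - n p. *)
  exists ((- w^-1)%:P, (w^-1 / n%:R) *: 'X) => /=.
  have n_neq0 : n%:R != 0 :> K by rewrite pnatr_eq0 -lt0n.
  have -> : p^`() = n%:R *: 'X^(n.-1).
    by rewrite derivB derivXn derivC subr0 scaler_nat.
  rewrite -scalerAl -scalerAr -exprS prednK // scalerA divfK // mul_polyC.
  by rewrite scalerBr !scaleNr opprK addrAC addNr add0r -mul_polyC -polyCM mulVf.
exists (tnth (Tuple size_rs)); split; first exact/tuple_uniqP.
move=> x; split=> [xn|[i <-]].
  have : x \in rs by rewrite -root_prod_XsubC -p_eq /root !hornerE xn subrr.
  by case/(@tnthP _ _ (Tuple size_rs)) => i ->; exists i.
have : root p (tnth (Tuple size_rs) i) by rewrite p_eq root_prod_XsubC mem_tnth.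
by rewrite /root !hornerE subr_eq0 => /eqP.
Qed.

(** * The Airy operator on one exponential component *)

Section AiryOperator.
Variables (C : numFieldType) (e n' q : nat).
Hypotheses (e_gt0 : (0 < e)%N) (q_gt0 : (0 < q)%N).
Local Notation n := n'.+1.
Variables (a b : nat -> C).
Hypothesis an : a n = 1.

Local Notation coef := (nat -> C^o).
Local Notation series := (C -> nat -> C^o).

Implicit Types (f : series) (h : coef) (Y : {poly C}).

Let e_neq0 : e%:R != 0 :> C.
Proof. by rewrite pnatr_eq0 -lt0n. Qed.

Definition ddx_part Y f : series := \sum_(i < n.+1) a i *: iter i (ddx e Y) f.

Definition pot_part f : series :=
  \sum_(j < (q * n).+1) b j *: (fun mu => f (mu + j%:R)).

Definition airy_op Y f : series := ddx_part Y f - pot_part f.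

Lemma iter_ddx_linear Y i (c : C) f f' :
  iter i (ddx e Y) (c *: f + f') = c *: iter i (ddx e Y) f + iter i (ddx e Y) f'.
Proof. by elim: i => //= i ->; rewrite ddx_linear. Qed.

Lemma airy_op_linear Y (c : C) f f' :
  airy_op Y (c *: f + f') = c *: airy_op Y f + airy_op Y f'.
Proof.
rewrite /airy_op scalerBr addrACA -opprD; congr (_ - _).
  rewrite /ddx_part scaler_sumr -big_split; apply: eq_bigr => i _ /=.
  by rewrite iter_ddx_linear scalerDr !scalerA mulrC.
rewrite /pot_part scaler_sumr -big_split; apply: eq_bigr => j _ /=.
apply/funext=> mu; apply/funext=> k.
rewrite -[LHS]/(b j * (c * f (mu + j%:R) k + f' (mu + j%:R) k)).
rewrite -[RHS]/(c * (b j * f (mu + j%:R) k) + b j * f' (mu + j%:R) k).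
by rewrite mulrDr mulrCA.
Qed.

Lemma airy_op_log_free Y f :
  (forall mu k, f mu k.+1 = 0) -> forall mu k, airy_op Y f mu k.+1 = 0.
Proof.
move=> f0.
have ddx0 f' : (forall mu k, f' mu k.+1 = 0) -> forall mu k, ddx e Y f' mu k.+1 = 0.
  move=> f'0 mu k; rewrite -[LHS]/(mulpoly e 1 Y f' mu k.+1 - z2_deriv f' mu k.+1).
  rewrite /mulpoly big1 => [|j _]; last by rewrite f'0 mulr0.
  by rewrite /z2_deriv !f'0 !mulr0 addr0 subr0.
have iter0 i : forall mu k, iter i (ddx e Y) f mu k.+1 = 0 by elim: i => //= i; exact: ddx0.
move=> mu k; rewrite -[LHS]/(ddx_part Y f mu k.+1 - pot_part f mu k.+1).
rewrite /ddx_part /pot_part !fct_sumE !big1 ?subr0 // => i _.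
  by rewrite -[LHS]/(b i * f (mu + i%:R) k.+1) f0 mulr0.
by rewrite -[LHS]/(a i * iter i (ddx e Y) f mu k.+1) iter0 mulr0.
Qed.

(** At a positive order j/e - 1, the derivations d/dx + dP/dx only count through
    dP/dx, and their powers of exponent less than n are negligible. *)
Lemma has_symbol_ddx_part Y (j : nat) :
    (e < j)%N -> (size Y <= j.+1)%N ->
  has_symbol e ((j%:R / e%:R - 1) * n%:R) (fun=> fun h => Y`_j ^+ n *: h) (ddx_part Y).
Proof.
move=> ltej leY; have j_gt0 : (0 < j)%N by lia.
have low (i : 'I_n) : has_symbol e ((j%:R / e%:R - 1) * n%:R) (fun=> fun=> 0)
    (fun f => a i *: iter i (ddx e Y) f).
  have l_gt0 : (0 < (n - i) * (j - e))%N.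
    by rewrite muln_gt0 !subn_gt0 ltej ltn_ord.
  have := has_symbolZ (a i) (has_symbol_iter_ddx e_gt0 i j_gt0 leY).
  move/(has_symbol_raise e_gt0 l_gt0); apply: has_symbol_ext => //.
  rewrite natrM natrB ?[in (j - e)%:R]natrB ?(ltnW ltej) //; last exact/ltnW/ltn_ord.
  by field.
have top := has_symbolZ (a n) (has_symbol_iter_ddx e_gt0 n j_gt0 leY).
apply: has_symbol_ext (has_symbolD (has_symbol_sum low) top) => // [mu h|f].
  by rewrite an scale1r add0r.
by rewrite /ddx_part [RHS]big_ord_recr.
Qed.

Lemma has_symbol_pot_part :
  has_symbol e (q * n)%:R (fun=> fun h => b (q * n)%N *: h) pot_part.
Proof.
have shift (j : nat) : has_symbol e j%:R (fun=> fun h => h) (fun f mu => f (mu + j%:R)).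
  by move=> mu f vf; split=> [l|]; rewrite ?subrK // addrAC subrK.
have low (j : 'I_(q * n)) : has_symbol e (q * n)%:R (fun=> fun=> 0)
    (fun f => b j *: (fun mu => f (mu + j%:R) : coef)).
  have l_gt0 : (0 < (q * n - j) * e)%N by rewrite muln_gt0 subn_gt0 ltn_ord.
  have := has_symbolZ (b j) (shift j).
  move/(has_symbol_raise e_gt0 l_gt0); apply: has_symbol_ext => //.
  rewrite natrM natrB; last exact/ltnW/ltn_ord.
  by field.
have top := has_symbolZ (b (q * n)%N) (shift (q * n)%N).
apply: has_symbol_ext (has_symbolD (has_symbol_sum low) top) => // [mu h|f].
  by rewrite add0r.
by rewrite /pot_part [RHS]big_ord_recr.
Qed.

(** Balance of orders: the derivatives contribute order n d when dP/dx has order d,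
    the potential contributes order q n, and neither may dominate nor the sum of
    the two leading coefficients survive. *)
Lemma airy_kernel_degree Y f :
    bounded_support e f -> f <> 0 -> airy_op Y f = 0 ->
  (size Y <= (q.+1 * e).+1)%N /\ Y`_(q.+1 * e) ^+ n = b (q * n)%N.
Proof.
move=> bf f_neq0 Lf0.
have [leY|gtY] := leqP (size Y) (q.+1 * e).+1.
  split=> //; have lte : (e < q.+1 * e)%N by nia.
  have hD := has_symbol_ddx_part lte leY.
  have ordE : ((q.+1 * e)%:R / e%:R - 1) * n%:R = (q * n)%:R :> C.
    by rewrite !natrM -[q.+1%:R]natr1; field.
  rewrite ordE in hD.
  have hL : has_symbol e (q * n)%:R
      (fun=> fun h => (Y`_(q.+1 * e) ^+ n - b (q * n)%N) *: h) (airy_op Y).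
    apply: has_symbol_ext (has_symbolD hD (has_symbolN has_symbol_pot_part)) => // mu h.
    by rewrite scalerBl.
  by have /eqP := kernel_scalar e_gt0 hL bf f_neq0 Lf0; rewrite subr_eq0 => /eqP.
set j := (size Y).-1; have sizeY : size Y = j.+1 by rewrite /j; lia.
have lt_qj : (q.+1 * e < j)%N by lia.
have lt_ej : (e < j)%N by nia.
have Yj_neq0 : Y`_j != 0.
  by rewrite -/(lead_coef Y) lead_coef_eq0 -size_poly_gt0 sizeY.
have leY : (size Y <= j.+1)%N by rewrite sizeY.
have l_gt0 : (0 < (j - q.+1 * e) * n)%N by rewrite muln_gt0 subn_gt0 lt_qj.
have hL : has_symbol e ((j%:R / e%:R - 1) * n%:R) (fun=> fun h => Y`_j ^+ n *: h) (airy_op Y).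
  have hP := has_symbol_raise e_gt0 l_gt0 (has_symbolN has_symbol_pot_part).
  have ordE : (q * n)%:R + ((j - q.+1 * e) * n)%:R / e%:R = (j%:R / e%:R - 1) * n%:R :> C.
    by rewrite !natrM natrB ?(ltnW lt_qj) // natrM -[q.+1%:R]natr1; field.
  rewrite ordE in hP.
  apply: has_symbol_ext (has_symbolD (has_symbol_ddx_part lt_ej leY) hP) => // mu h.
  by rewrite addr0.
have /eqP := kernel_scalar e_gt0 hL bf f_neq0 Lf0.
by rewrite expf_eq0 (negPf Yj_neq0) andbF.
Qed.

Definition ddx_rem_part Y f : series := \sum_(i < n.+1) a i *: ddx_rem e Y i f.

(** The operator is the multiplication by the polynomial equation plus corrections,
    whose order is computed next. *)
Lemma airy_op_split Y f :
  airy_op Y f = mulpoly e n%:R (airy_poly n q a b e Y) f + ddx_rem_part Y f.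
Proof.
have mulpoly_sum (I : Type) (r : seq I) (F : I -> {poly C}) s :
    mulpoly e s (\sum_(i <- r) F i) f = \sum_(i <- r) mulpoly e s (F i) f.
  elim: r => [|i r IH]; first by rewrite !big_nil mulpoly0.
  by rewrite !big_cons mulpolyD IH.
rewrite /airy_poly -scaleN1r mulpolyD mulpolyZ !mulpoly_sum scaleN1r addrAC.
rewrite /airy_op; congr (_ - _).
  rewrite /ddx_part /ddx_rem_part -big_split; apply: eq_bigr => i _.
  rewrite /= mulpolyZ -scalerDr; congr (_ *: _).
  have lei : (i <= n)%N by rewrite -ltnS.
  have ordE : n%:R = i%:R + (n - i)%:R :> C by rewrite natrB // addrC subrK.
  rewrite -(mulpoly_shift e_gt0 (Y ^+ i) f ordE) /ddx_rem.
  by move: (iter _ _ _) (mulpoly _ _ _ _) => x y; rewrite addrC subrK.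
rewrite /pot_part; apply: eq_bigr => j _; rewrite mulpolyZ; congr (_ *: _).
have ordE : n%:R = - j%:R + (j + n)%:R :> C by rewrite natrD addKr.
rewrite -['X^_]mul1r -(mulpoly_shift e_gt0 1 f ordE).
by apply/funext=> mu; apply/funext=> k; rewrite mulpolyC mul1r opprK.
Qed.

(** Only the derivative of order n counts in the correction, because q > 0. *)
Lemma has_symbol_ddx_rem_part Y :
    (size Y <= (q.+1 * e).+1)%N ->
  has_symbol e (q%:R * n'%:R - 1)
    (fun mu h => - Y`_(q.+1 * e) ^+ n' *:
       ((n%:R * mu - q%:R * 'C(n, 2)%:R) *: h + n%:R *: log_shift h))
    (ddx_rem_part Y).
Proof.
move=> leY.
have low (i : 'I_n) : has_symbol e (q%:R * n'%:R - 1) (fun=> fun=> 0)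
    (fun f => a i *: ddx_rem e Y i f).
  case: i => -[|i] lti.
    have rem0 f : ddx_rem e Y 0 f = 0.
      apply/funext=> mu; apply/funext=> k.
      rewrite -[LHS]/(f mu k - mulpoly e 0 1 f mu k).
      by rewrite mulpolyC mul1r subr0 subrr.
    by move=> mu f _; rewrite /= rem0 scaler0.
  have l_gt0 : (0 < q * (n' - i) * e)%N.
    by rewrite !muln_gt0 q_gt0 e_gt0 subn_gt0 -ltnS lti.
  have := has_symbolZ (a i.+1) (has_symbol_ddx_rem e_gt0 i leY).
  move/(has_symbol_raise e_gt0 l_gt0); apply: has_symbol_ext => //.
  rewrite !natrM natrB; last by lia.
  by field.
have top := has_symbolZ (a n) (has_symbol_ddx_rem e_gt0 n' leY).
apply: has_symbol_ext (has_symbolD (has_symbol_sum low) top) => // [mu h|f].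
  by rewrite an scale1r add0r.
by rewrite /ddx_rem_part [RHS]big_ord_recr.
Qed.

(** Compare Y with a Y' that solves the polynomial equation up to the order of the
    correction. If they differ in degree w and agree above, then the equation for Y has
    an extra leading term, with coefficient n c^(n-1) (Y - Y')`_w. Its order
    exceeds that of the correction since w > 0, so that the operator has an
    invertible constant symbol. *)
Lemma airy_kernel_unique Y Y' f :
    bounded_support e f -> f <> 0 -> airy_op Y f = 0 ->
    (size Y <= (q.+1 * e).+1)%N -> (size Y' <= (q.+1 * e).+1)%N ->
    Y`_(q.+1 * e) = Y'`_(q.+1 * e) -> Y`_(q.+1 * e) != 0 -> Y`_0 = Y'`_0 ->
    (size (airy_poly n q a b e Y') <= (q.+1 * n' * e).+1)%N ->
  Y = Y'.
Proof.
move=> bf f_neq0 Lf0 leY leY' eqc; set c := Y`_(q.+1 * e) => c_neq0 eq0 leG.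
apply/eqP; rewrite -subr_eq0; apply: contrapT => /negP d_neq0.
pose w := (size (Y - Y')).-1.
have size_d : size (Y - Y') = w.+1 by rewrite prednK // size_poly_gt0.
have dw_neq0 : (Y - Y')`_w != 0 by rewrite -/(lead_coef _) lead_coef_eq0.
have w_gt0 : (0 < w)%N.
  rewrite lt0n; apply: contraNneq dw_neq0 => ->.
  by rewrite coefB eq0 subrr.
(* The degree of the extra term: w plus n - 1 times the degree of Y. *)
pose K := (w + q.+1 * e * n')%N.
have diff i : Y ^+ i.+1 - Y' ^+ i.+1 =
    (Y - Y') * \sum_(k < i.+1) Y ^+ (i - k) * Y' ^+ k.
  by rewrite subrXX.
have size_S i : (size (\sum_(k < i.+1) Y ^+ (i - k) * Y' ^+ k)%R <= (q.+1 * e * i).+1)%N.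
  apply: (leq_trans (size_sum _ _ _)); apply/bigmax_leqP => k _.
  have lek : (k <= i)%N by rewrite -ltnS.
  have -> : (q.+1 * e * i = q.+1 * e * (i - k) + q.+1 * e * k)%N.
    by rewrite -mulnDr subnK.
  by apply: size_mul_leqS; exact: size_exp_leqS.
have coef_S i : (\sum_(k < i.+1) Y ^+ (i - k) * Y' ^+ k)`_(q.+1 * e * i) = i.+1%:R * c ^+ i.
  rewrite coef_sum (eq_bigr (fun=> c ^+ i)) => [|k _].
    by rewrite sumr_const card_ord mulr_natl.
  have lek : (k <= i)%N by rewrite -ltnS.
  have -> : (q.+1 * e * i = q.+1 * e * (i - k) + q.+1 * e * k)%N.
    by rewrite -mulnDr subnK.
  rewrite coefM_top ?coef_exp_top ?size_exp_leqS //.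
  by rewrite -eqc -exprD subnK.
have size_D i : (size (Y ^+ i.+1 - Y' ^+ i.+1)%R <= (w + q.+1 * e * i).+1)%N.
  by rewrite diff size_mul_leqS ?size_d.
have G_eq : airy_poly n q a b e Y = airy_poly n q a b e Y' +
    \sum_(i < n) a i.+1 *: ((Y ^+ i.+1 - Y' ^+ i.+1) * 'X^((n' - i) * e)).
  rewrite /airy_poly addrAC; congr (_ - _).
  rewrite [LHS]big_ord_recl [X in _ = X + _]big_ord_recl /= !expr0 -addrA; congr (_ + _).
  rewrite -big_split; apply: eq_bigr => i _ /=.
  by rewrite -scalerDr -mulrDl addrCA subrr addr0.
have leT (i : nat) : (size (a i.+1 *: ((Y ^+ i.+1 - Y' ^+ i.+1) * 'X^((n' - i) * e)))%R
    <= (w + q.+1 * e * i + (n' - i) * e).+1)%N.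
  by rewrite (leq_trans (size_scale_leq _ _)) // size_mul_leqS ?size_polyXn.
have ltT i : (i < n')%N -> (w + q.+1 * e * i + (n' - i) * e < K)%N.
  move=> lti; rewrite /K.
  have -> : (q.+1 * e * n' = q.+1 * e * i + q.+1 * e * (n' - i))%N.
    by rewrite -mulnDr subnKC // ltnW.
  have : (0 < q * e * (n' - i))%N by rewrite !muln_gt0 q_gt0 e_gt0 subn_gt0.
  nia.
have leGK : (q.+1 * n' * e < K)%N by rewrite /K; nia.
have coef_G : (airy_poly n q a b e Y)`_K = n%:R * (Y - Y')`_w * c ^+ n'.
  rewrite G_eq coefD nth_default ?add0r; last by rewrite (leq_trans leG).
  rewrite big_ord_recr /= coefD coef_sum big1 ?add0r => [|i _]; last first.
    rewrite nth_default // (leq_trans (leT i)) //; exact: ltT.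
  rewrite an scale1r subnn mulr1 diff coefM_top ?size_d //.
  by rewrite coef_S mulrCA mulrA.
have size_G : (size (airy_poly n q a b e Y) <= K.+1)%N.
  rewrite G_eq (leq_trans (size_polyD _ _)) // geq_max; apply/andP; split.
    by rewrite (leq_trans leG) // ltnS ltnW.
  apply: (leq_trans (size_sum _ _ _)); apply/bigmax_leqP => i _.
  rewrite (leq_trans (leT i)) // ltnS.
  have := ltn_ord i; rewrite ltnS leq_eqVlt => /predU1P[->|/ltT/ltnW //].
  by rewrite subnn addn0.
have hM := has_symbol_mulpoly e_gt0 n%:R size_G.
have hR := has_symbol_raise e_gt0 w_gt0 (has_symbol_ddx_rem_part leY).
have ordE : q%:R * n'%:R - 1 + w%:R / e%:R = K%:R / e%:R - n%:R :> C.
  by rewrite /K natrD !natrM -[q.+1%:R]natr1 -[n%:R]natr1; field.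
rewrite ordE in hR.
have hL : has_symbol e (K%:R / e%:R - n%:R)
    (fun=> fun h => (n%:R * (Y - Y')`_w * c ^+ n') *: h) (airy_op Y).
  apply: has_symbol_ext (has_symbolD hM hR) => // [mu h|g].
    by rewrite coef_G addr0.
  by rewrite airy_op_split.
have /eqP := kernel_scalar e_gt0 hL bf f_neq0 Lf0.
by rewrite !mulf_eq0 expf_eq0 (negPf c_neq0) (negPf dw_neq0) pnatr_eq0 andbF.
Qed.

(** When Y solves the polynomial equation up to the order of the correction, the
    symbol of the correction takes over, and the indicial equation has degree 1. *)
Lemma airy_kernel_dim1 Y :
    (size Y <= (q.+1 * e).+1)%N -> Y`_(q.+1 * e) != 0 ->
    (size (airy_poly n q a b e Y) <= (q.+1 * n' * e).+1)%N ->
  exists (lambda : C) (v : nat -> C),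
    [/\ v 0%N = 1, airy_op Y (log_series e lambda [:: v]) = 0
      & forall f, bounded_support e f -> airy_op Y f = 0 ->
          exists c : C, f = c *: log_series e lambda [:: v]].
Proof.
move=> leY; set c := Y`_(q.+1 * e) => c_neq0 leG.
pose g := (airy_poly n q a b e Y)`_(q.+1 * n' * e).
pose kappa := - (n%:R * c ^+ n').
have n_neq0 : n%:R != 0 :> C by rewrite pnatr_eq0.
have kappa_neq0 : kappa != 0 by rewrite oppr_eq0 mulf_neq0 // expf_neq0.
(* The root of g - c^(n-1) (n mu - q 'C(n, 2)) = 0. *)
pose lambda := q%:R * 'C(n, 2)%:R / n%:R - g / kappa.
have hM := has_symbol_mulpoly e_gt0 n%:R leG.
have hR := has_symbol_ddx_rem_part leY.
have ordE : (q.+1 * n' * e)%:R / e%:R - n%:R = q%:R * n'%:R - 1 :> C.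
  by rewrite !natrM -[q.+1%:R]natr1 -[n%:R]natr1; field.
rewrite ordE in hM.
have hL : has_symbol e (q%:R * n'%:R - 1)
    (fun mu h => kappa *: ((mu - lambda) *: h + log_shift h)) (airy_op Y).
  apply: has_symbol_ext (has_symbolD hM hR) => // [mu h|f]; last first.
    by rewrite airy_op_split.
  apply/funext=> k; rewrite -/g -/c.
  rewrite -[LHS]/(g * h k + - c ^+ n' *
    ((n%:R * mu - q%:R * 'C(n, 2)%:R) * h k + n%:R * log_shift h k)).
  rewrite -[RHS]/(kappa * ((mu - lambda) * h k + log_shift h k)).
  pose t := g / kappa; have gE : g = kappa * t by rewrite mulrC divfK.
  rewrite /lambda -/t gE /kappa.
  by field; rewrite nat1r.
have [v v0 Lv0] := exists_solution e_gt0 (airy_op_linear Y) kappa_neq0 hL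
  (@airy_op_log_free Y).
exists lambda, v; split=> // f bf Lf0.
exact: (kernel_dim1 e_gt0 (airy_op_linear Y) kappa_neq0 hL v0 Lv0 bf Lf0).
Qed.

End AiryOperator.

(** * Determining factors *)

Section Components.
Variables (R : realType) (e : nat).
Hypothesis e_gt0 : (0 < e)%N.
Local Notation C := R[i].
Implicit Types (p : {poly C}) (u : formal R).

Let e_neq0 : e%:R != 0 :> C.
Proof. by rewrite pnatr_eq0 -lt0n. Qed.

(** For P = p(z^(-1/e)) = p(x^(1/e)), one has dP/dx = z (slope p)(z^(-1/e)). *)
Definition slope p : {poly C} := \poly_(j < size p) (j%:R / e%:R * p`_j).

Lemma coef_slope p j : (slope p)`_j = j%:R / e%:R * p`_j.
Proof. by rewrite coef_poly; case: ltnP => // /(nth_default 0) ->; rewrite mulr0. Qed.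

Lemma slope_inj p p' : p`_0 = 0 -> p'`_0 = 0 -> slope p = slope p' -> p = p'.
Proof.
move=> p0 p'0 eqs; apply/polyP => -[|j]; first by rewrite p0 p'0.
have := congr1 (fun g : {poly C} => g`_j.+1) eqs; rewrite !coef_slope.
by apply: mulfI; rewrite mulf_neq0 ?invr_eq0 // pnatr_eq0.
Qed.

Lemma derivx_component u p : derivx e u p = ddx e (slope p) (u p).
Proof.
apply/funext=> mu; apply/funext=> k.
rewrite -[LHS]/(- derivz e u p (mu - 2) k).
rewrite -[RHS]/(mulpoly e 1 (slope p) (u p) mu k - z2_deriv (u p) mu k).
rewrite /derivz /z2_deriv opprB (_ : mu - 2 + 1 = mu - 1); last by ring.
congr (_ - _); rewrite (@mulpoly_wide _ _ (size p)) ?size_poly //.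
by apply: eq_bigr => j _; rewrite coef_slope.
Qed.

(** The Airy operator respects the decomposition of a formal series according to
    its exponentials, on each of which it becomes a conjugate. *)
Lemma airy_component n' q (a b : nat -> C) u p : a 0%N = 0 ->
  airy e n'.+1 (q * n'.+1) a b u p = airy_op e n' q a b (slope p) (u p).
Proof.
move=> a0.
have iterE i : iter i (derivx e) u p = iter i (ddx e (slope p)) (u p).
  by elim: i => //= i IH; rewrite derivx_component IH.
apply/funext=> mu; apply/funext=> k.
rewrite -[LHS]/((\sum_(1 <= i < n'.+2) a i *: iter i (derivx e) u) p mu k
  - (\sum_(j < (q * n'.+1).+1) b j *: mulz (- j%:R) u) p mu k).
rewrite -[RHS]/(ddx_part e n' a (slope p) (u p) mu k - pot_part n' q b (u p) mu k).
rewrite /ddx_part /pot_part !fct_sumE; congr (_ - _).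
  rewrite [RHS]big_ord_recl a0 -[X in _ = X + _]/(0 * u p mu k) mul0r add0r.
  rewrite big_add1 big_mkord /=; apply: eq_bigr => i _.
  by rewrite -[LHS]/(a i.+1 * iter i.+1 (derivx e) u p mu k) iterE.
apply: eq_bigr => j _.
by rewrite -[LHS]/(b j * u p (mu - - j%:R) k) opprK.
Qed.

Lemma exp_term_component (Q : {poly C}) (lambda : C) (v : seq (nat -> C)) p :
  exp_term e Q lambda v p = if p == Q then log_series e lambda v else 0.
Proof.
apply/funext=> mu; apply/funext=> k; rewrite /exp_term.
by case: eqP.
Qed.

Lemma is_formal_bounded u p : is_formal e u -> bounded_support e (u p).
Proof.
move=> [r [Q [lambda [v [_ ->]]]]]; rewrite fct_sumE.
apply: bounded_sum => i; rewrite exp_term_component.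
case: eqP => _; first exact: bounded_log_series.
exact: bounded0.
Qed.

Lemma is_formal_constant_term u p : is_formal e u -> u p <> 0 -> p`_0 = 0.
Proof.
move=> [r [Q [lambda [v [Q0 ->]]]]]; rewrite fct_sumE => neq0.
apply: contrapT => p0; apply: neq0; apply: big1 => i _.
by rewrite exp_term_component; case: eqP => // p_eq; case: p0; rewrite p_eq.
Qed.

Lemma is_formal_exp_term (Q : {poly C}) (lambda : C) (v : seq (nat -> C)) :
  Q`_0 = 0 -> is_formal e (exp_term e Q lambda v).
Proof.
move=> Q0; exists 1%N, (fun=> Q), (fun=> lambda), (fun=> v); split=> //.
by rewrite big_ord1.
Qed.

(** Each exponential of one basis occurs in the other, as the corresponding solution
    is a combination of the elements of the other basis. Hence the determining
    factors, as a set, do not depend on the basis. *)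
Lemma determining_factors_sub n n' (L : formal R -> formal R)
    (Q : 'I_n -> {poly C}) (Q' : 'I_n' -> {poly C}) :
  determining_factors e L Q -> determining_factors e L Q' ->
  forall i, exists j, Q' j = Q i.
Proof.
move=> [_ [lambda [v [uS u_free _]]]] [_ [lambda' [v' [_ _ u'_span]]]] i.
have [c u_eq] := u'_span _ (uS i).
apply: contrapT => none.
have u0 : exp_term e (Q i) (lambda i) (v i) = 0.
  apply/funext=> p; have [->|neq_p] := eqVneq p (Q i); last first.
    by rewrite exp_term_component (negPf neq_p).
  rewrite u_eq fct_sumE; apply: big1 => j _.
  apply/funext=> mu; rewrite -[LHS]/(c j *: exp_term e (Q' j) (lambda' j) (v' j) (Q i) mu).
  rewrite exp_term_component; case: eqP => [eqQ|_]; last exact: scaler0.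
  by case: none; exists j.
have := u_free (fun j => (j == i)%:R) _ i; rewrite eqxx => one0.
have /eqP : (1 : C) = 0; last by rewrite oner_eq0.
apply: one0; rewrite (bigD1 i) //=.
rewrite u0 scaler0 add0r.
have kron0 j : j != i -> (j == i)%:R = 0 :> C by move/negPf->.
by apply: big1 => j neq_j; rewrite kron0 // scale0r.
Qed.

Lemma determining_factors_eq n n' (L : formal R -> formal R)
    (Q : 'I_n -> {poly C}) (Q' : 'I_n' -> {poly C}) p :
    determining_factors e L Q -> determining_factors e L Q' ->
  (exists i, Q i = p) <-> (exists i, Q' i = p).
Proof.
by move=> dQ dQ'; split=> -[i <-]; [exact: determining_factors_sub dQ dQ' i
  | exact: determining_factors_sub dQ' dQ i].
Qed.

End Components.

Section Airy.
Variables (R : realType) (n' q : nat).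
Hypothesis q_gt0 : (0 < q)%N.
Local Notation C := R[i].
Local Notation n := n'.+1.
Variables (a b : nat -> C).
Hypotheses (a0 : a 0%N = 0) (an : a n = 1) (bm : b (q * n)%N <> 0).
Implicit Types (alpha : 'I_q.+1 -> C) (e : nat).

Lemma systemA_root alpha : systemA n a b alpha ->
  (- alpha ord0) ^+ n = b (q * n)%N.
Proof.
case=> /(_ 0%N q_gt0); rewrite /beta subn0 -horner_coef0 horner_exp horner_coef0.
rewrite coef_sum (bigD1 ord0) //= big1 ?addr0 => [|j j_neq0].
  rewrite coefZ coefXn eqxx mulr1 [(- alpha _) ^+ _]exprNn => -> _.
  by rewrite mulrA -exprD addnn -mul2n exprM sqrrN !expr1n mul1r.
rewrite coefZ coefXn; case: eqP => [j0|_]; last by rewrite mulr0.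
by case/eqP: j_neq0; exact: val_inj.
Qed.

Lemma systemA_neq0 alpha : systemA n a b alpha -> alpha ord0 != 0.
Proof.
move=> /systemA_root eqb; apply/eqP=> al0; apply: bm.
by rewrite -eqb al0 oppr0 expr0n.
Qed.

(** The system prescribes the coefficients up to degree q of the n-th power of
    alpha_0 + alpha_n z + ... + alpha_(qn) z^q. *)
Lemma exists_systemA (c : C) : c ^+ n = b (q * n)%N ->
  exists alpha, systemA n a b alpha /\ alpha ord0 = - c.
Proof.
move=> cn; have c_neq0 : - c != 0.
  rewrite oppr_eq0; apply/eqP=> c0; apply: bm.
  by rewrite -cn c0 expr0n.
(* The right hand sides of the system, where beta_(0,n-1) is already known. *)
pose t s := (-1) ^+ n * b (q * n - s)%N + (s == q)%:R * (a n' * (- c) ^+ n').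
have ct : (- c) ^+ n = t 0%N.
  rewrite /t subn0 -cn [(- c) ^+ n]exprNn; case: eqP q_gt0 => [<- //|_ _].
  by rewrite mul0r addr0.
have [P [leP P0 Pt]] := exists_power_root q (ltn0Sn n') c_neq0 ct.
exists (fun j : 'I_q.+1 => P`_j); split=> //.
have PE : \sum_(j < q.+1) P`_j *: 'X^j = P.
  rewrite -(poly_def q.+1 (fun j => P`_j)); apply/polyP=> j; rewrite coef_poly.
  by case: ltnP => // lej; rewrite nth_default // (leq_trans leP).
rewrite /systemA /beta PE; split=> [s lts|].
  by rewrite Pt 1?ltnW // /t (ltn_eqF lts) mul0r addr0.
rewrite Pt // /t eqxx mul1r addrC; congr (a _ * _ + _).
by rewrite -horner_coef0 horner_exp horner_coef0 P0.
Qed.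

Section Ramified.
Variables (e : nat) (e_gt0 : (0 < e)%N).

Lemma Qalpha_comp0 alpha : (Qalpha alpha \Po 'X^e)`_0 = 0.
Proof.
rewrite coef_comp_poly_Xn // dvdn0 div0n /Qalpha coefN coef_sum big1 ?oppr0 // => j _.
by rewrite coefZ coefXn eq_sym subn_eq0 leqNgt ltn_ord mulr0.
Qed.

Lemma slope_Qalpha alpha :
  slope e (Qalpha alpha \Po 'X^e) = (- reversal alpha) \Po 'X^e.
Proof.
apply/polyP=> k; rewrite coef_slope !coef_comp_poly_Xn //.
case: ifP => [/dvdnP[l ->]|_]; last by rewrite mulr0.
rewrite mulnK // /Qalpha /reversal !coefN !coef_sum mulrN; congr (- _).
rewrite mulr_sumr; apply: eq_bigr => j _; rewrite !coefZ !coefXn.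
case: eqP => [->|_]; last by rewrite !mulr0.
have j_neq0 : (q.+1 - j)%:R != 0 :> C.
  by rewrite pnatr_eq0 subn_eq0 -ltnNge ltn_ord.
have e_neq0 : e%:R != 0 :> C by rewrite pnatr_eq0 -lt0n.
by rewrite natrM !mulr1; field; rewrite j_neq0 e_neq0.
Qed.

Let Y alpha := slope e (Qalpha alpha \Po 'X^e).

Lemma slope_Qalpha_size alpha : (size (Y alpha) <= (q.+1 * e).+1)%N.
Proof. by rewrite /Y slope_Qalpha size_comp_Xn // size_polyN size_reversal. Qed.

Lemma slope_Qalpha_top alpha : (Y alpha)`_(q.+1 * e) = - alpha ord0.
Proof.
rewrite /Y slope_Qalpha coef_comp_poly_Xn // dvdn_mull // mulnK // coefN; congr (- _).
rewrite coef_sum (bigD1 ord0) //= big1 ?addr0 => [|j j_neq0].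
  by rewrite coefZ coefXn subn0 eqxx mulr1.
rewrite coefZ coefXn; case: eqP => [eqj|_]; last by rewrite mulr0.
by move: j_neq0; rewrite -val_eqE /=; have := ltn_ord j; lia.
Qed.

Lemma slope_Qalpha_airy_poly alpha : systemA n a b alpha ->
  (size (airy_poly n q a b e (Y alpha)) <= (q.+1 * n' * e).+1)%N.
Proof.
case=> sysA sysA_q; rewrite /Y slope_Qalpha airy_poly_comp size_comp_Xn //.
exact: size_airy_poly_reversal.
Qed.

(** Existence, and uniqueness up to a constant, of the solution with exponential
    Q_alpha, for any ramification e. *)
Lemma airy_exp_solution alpha : systemA n a b alpha ->
  exists (lambda : C) (v : nat -> C),
    [/\ v 0%N = 1, airy_op e n' q a b (Y alpha) (log_series e lambda [:: v]) = 0
      & forall f, bounded_support e f -> airy_op e n' q a b (Y alpha) f = 0 ->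
          exists c : C, f = c *: log_series e lambda [:: v]].
Proof.
move=> sysA; apply: airy_kernel_dim1 => //.
- exact: slope_Qalpha_size.
- by rewrite slope_Qalpha_top oppr_eq0 systemA_neq0.
- exact: slope_Qalpha_airy_poly.
Qed.

(** No other exponential occurs in a solution: the leading coefficient c of dP/dx is
    an n-th root of b_m, and the solution alpha of the system with
    alpha_0 = - c gives dP/dx and therefore P. *)
Lemma airy_solution_exponent (p : {poly C}) (f : C -> nat -> C^o) :
    p`_0 = 0 -> bounded_support e f -> f <> 0 -> airy_op e n' q a b (slope e p) f = 0 ->
  exists2 c, c ^+ n = b (q * n)%N &
    forall alpha, systemA n a b alpha -> alpha ord0 = - c ->
      p = Qalpha alpha \Po 'X^e.
Proof.
move=> p0 bf f_neq0 Lf0.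
have [leY cn] := airy_kernel_degree e_gt0 q_gt0 an bf f_neq0 Lf0.
exists (slope e p)`_(q.+1 * e) => // alpha sysA al0.
apply: (slope_inj e_gt0) => //; first exact: Qalpha_comp0.
have c_eq : (slope e p)`_(q.+1 * e) = (Y alpha)`_(q.+1 * e).
  by rewrite slope_Qalpha_top al0 opprK.
apply: (airy_kernel_unique e_gt0 q_gt0 an bf f_neq0 Lf0 leY
  (slope_Qalpha_size alpha) c_eq).
- by rewrite c_eq slope_Qalpha_top oppr_eq0 systemA_neq0.
- by rewrite !coef_slope !mul0r.
- exact: slope_Qalpha_airy_poly.
Qed.

(** The n solutions have distinct exponentials, so they are independent, and a formal
    solution is the sum of its components, each proportional to one of them. *)
Lemma airy_determining_factors (alpha : 'I_n -> 'I_q.+1 -> C) :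
    (forall i, systemA n a b (alpha i)) ->
    injective (fun i => alpha i ord0) ->
    (forall c, c ^+ n = b (q * n)%N -> exists i, alpha i ord0 = - c) ->
  determining_factors e (airy e n (q * n) a b) (fun i => Qalpha (alpha i) \Po 'X^e).
Proof.
move=> sysA al_inj al_surj; pose Q i := Qalpha (alpha i) \Po 'X^e.
have Q_inj : injective Q.
  move=> i j eqQ; apply: al_inj; apply: oppr_inj.
  by rewrite -!slope_Qalpha_top /Y -/(Q i) eqQ.
split=> [i|]; first exact: Qalpha_comp0.
have /choice[lambda /choice[v uP]] := fun i => airy_exp_solution (sysA i).
pose u i := exp_term e (Q i) (lambda i) [:: v i].
have uE i : u i (Q i) = log_series e (lambda i) [:: v i].
  by rewrite /u exp_term_component eqxx.
have uN i p : p <> Q i -> u i p = 0.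
  by rewrite /u exp_term_component; case: eqP.
have sumE (c : 'I_n -> C) i : (\sum_(j < n) c j *: u j) (Q i) = c i *: u i (Q i).
  rewrite fct_sumE (bigD1 i) //= big1 ?addr0 // => j /eqP neq_j.
  apply/funext=> mu; rewrite -[LHS]/(c j *: u j (Q i) mu) uN ?scaler0 //.
  by move/Q_inj => eq_j; case: neq_j.
exists lambda, (fun i => [:: v i]); split.
- move=> i; split; first exact: is_formal_exp_term (Qalpha_comp0 _).
  have [_ Lu _] := uP i.
  apply/funext=> p; rewrite airy_component // -/(u i).
  have [->|/eqP neq_p] := eqVneq p (Q i); first by rewrite uE.
  have := @airy_op_linear _ e n' q a b (slope e p) (-1) 0 0.
  by rewrite uN // scaler0 addr0 scaleN1r addNr.
- move=> c sum0 i; have [v0 _ _] := uP i.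
  have := sumE c i; rewrite sum0 uE.
  move=> /(congr1 (fun f : C -> nat -> C^o => f (lambda i + 0%:R / e%:R) 0%N)).
  rewrite -[RHS]/(c i * log_series e (lambda i) [:: v i] (lambda i + 0%:R / e%:R) 0%N).
  by rewrite log_series_on //= v0 mulr1.
- move=> w [fw Lw0].
  have Lw p : airy_op e n' q a b (slope e p) (w p) = 0 by rewrite -airy_component // Lw0.
  have : forall i, exists c : C, w (Q i) = c *: u i (Q i).
    move=> i; have [_ _ span] := uP i; rewrite uE; apply: span.
      exact: is_formal_bounded.
    exact: Lw.
  move=> /choice[c wc]; exists c; apply/funext=> p.
  have [[i ->]|none] := pselect (exists i, p = Q i); first by rewrite sumE.
  rewrite fct_sumE big1 => [|j _]; last first.
    apply/funext=> mu; rewrite -[LHS]/(c j *: u j p mu) uN ?scaler0 // => p_eq.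
    by apply: none; exists j.
  apply: contrapT => wp_neq0.
  have p0 := is_formal_constant_term fw wp_neq0.
  have [d dn eq_p] := airy_solution_exponent p0 (is_formal_bounded e_gt0 p fw) wp_neq0 (Lw p).
  have [i al_i] := al_surj d dn.
  by apply: none; exists i; exact: eq_p.
Qed.

(** The system has one solution for each of the n values of alpha_0. *)
Lemma airy_systemA_family :
  exists alpha : 'I_n -> 'I_q.+1 -> C,
    [/\ forall i, systemA n a b (alpha i), injective (fun i => alpha i ord0)
      & forall c, c ^+ n = b (q * n)%N -> exists i, alpha i ord0 = - c].
Proof.
have bm_neq0 : b (q * n)%N != 0 by exact/eqP.
have [r [r_inj rP]] := exists_roots (ltn0Sn n') bm_neq0.
have : forall i, exists alpha, systemA n a b alpha /\ alpha ord0 = - r i.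
  by move=> i; apply: exists_systemA; apply/rP; exists i.
move=> /choice[alpha alP]; exists alpha; split=> [i|i j|c /rP[i <-]].
- by have [] := alP i.
- by have [_ ->] := alP i; have [_ ->] := alP j; move/oppr_inj/r_inj.
- by exists i; have [] := alP i.
Qed.

Lemma determining_factorsP (Q : 'I_n -> {poly C}) (p : {poly C}) :
    determining_factors e (airy e n (q * n) a b) Q ->
  (exists i, Q i = p) <->
  (exists alpha, systemA n a b alpha /\ p = Qalpha alpha \Po 'X^e).
Proof.
move=> dQ; have [alpha [sysA al_inj al_surj]] := airy_systemA_family.
have dQ' := airy_determining_factors sysA al_inj al_surj.
rewrite (determining_factors_eq p dQ dQ'); split=> [[i <-]|[al [sys_al ->]]].
  by exists (alpha i).
have [lambda [v [v0 Lv0 _]]] := airy_exp_solution sys_al.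
have f_neq0 : log_series e lambda [:: v] <> 0.
  move/(congr1 (fun f : C -> nat -> C^o => f (lambda + 0%:R / e%:R) 0%N)).
  by rewrite log_series_on //= v0 => /eqP; rewrite oner_eq0.
have [c cn eq_al] := airy_solution_exponent (Qalpha_comp0 al)
  (bounded_log_series e_gt0 lambda [:: v]) f_neq0 Lv0.
have [i al_i] := al_surj c cn.
by exists i; rewrite -eq_al.
Qed.

End Ramified.
End Airy.

Theorem proposition1p2p2 (R : realType) (n q : nat) (hn : (1 <= n)%N)
    (hq : (1 <= q)%N) (a b : nat -> R[i]) (ha0 : a 0%N = 0) (han : a n = 1)
    (hbm : b (q * n)%N <> 0) :
  [/\ exists (e : nat) (Q : 'I_n -> {poly R[i]}),
        (0 < e)%N /\ determining_factors e (airy e n (q * n) a b) Q,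
      forall (e : nat) (Q : 'I_n -> {poly R[i]}), (0 < e)%N ->
        determining_factors e (airy e n (q * n) a b) Q ->
        forall p : {poly R[i]},
          (exists i, Q i = p) <->
          (exists alpha : 'I_q.+1 -> R[i],
             systemA n a b alpha /\ p = Qalpha alpha \Po 'X^e)
    & forall a' b' : nat -> R[i],
        a' 0%N = 0 -> a' n = 1 -> b' (q * n)%N <> 0 ->
        a' n.-1 = a n.-1 ->
        (forall s : nat, (s <= q)%N -> b' (q * n - s)%N = b (q * n - s)%N) ->
        forall (e e' : nat) (Q Q' : 'I_n -> {poly R[i]}),
          (0 < e)%N -> (0 < e')%N ->
          determining_factors e (airy e n (q * n) a b) Q ->
          determining_factors e' (airy e' n (q * n) a' b') Q' ->
          forall p : {poly R[i]},
            (exists i, Q i \Po 'X^e' = p) <->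
            (exists i, Q' i \Po 'X^e = p)].
Proof.
case: n hn han hbm => // n' _ han hbm; split.
- have [alpha [sysA al_inj al_surj]] := airy_systemA_family hq a hbm.
  exists 1%N, (fun i => Qalpha (alpha i) \Po 'X^1); split=> //.
  exact: airy_determining_factors.
- by move=> e Q e_gt0 dQ p; exact: determining_factorsP.
- move=> a' b' ha'0 ha'n hb'm eqa eqb e e' Q Q' e_gt0 e'_gt0 dQ dQ' p.
  have sysE (alpha : 'I_q.+1 -> R[i]) :
      systemA n'.+1 a' b' alpha <-> systemA n'.+1 a b alpha.
    rewrite /systemA eqa eqb //.
    by split=> -[sysA ->]; split=> // s lts; rewrite sysA // eqb // ltnW.
  have twist k l : ('X^k \Po 'X^l : {poly R[i]}) = 'X^l \Po 'X^k.
    by rewrite !comp_Xn_poly -!exprM mulnC.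
  have QP := determining_factorsP hq ha0 han hbm e_gt0 _ dQ.
  have Q'P := determining_factorsP hq ha'0 ha'n hb'm e'_gt0 _ dQ'.
  split=> -[i <-].
    have [|alpha [sysA ->]] := (QP (Q i)).1; first by exists i.
    have [|j Q'j] := (Q'P (Qalpha alpha \Po 'X^e')).2; first by exists alpha; rewrite sysE.
    by exists j; rewrite Q'j -!comp_polyA twist.
  have [|alpha [sysA ->]] := (Q'P (Q' i)).1; first by exists i.
  have [|j Qj] := (QP (Qalpha alpha \Po 'X^e)).2; first by exists alpha; rewrite -sysE.
  by exists j; rewrite Qj -!comp_polyA twist.
Qed.
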